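(* Let $K$ be a compact group acting orthogonally on $\mathbb{R}^n$, and let $\{\rho_1,\dots,\rho_\ell\}$ be a set of generators of the algebra $\mathcal{P}(\mathbb{R}^n)^K$ of $K$-invariant polynomials on $\mathbb{R}^n$. Then for every $K$-invariant function $f\in L^1(\mathbb{R}^n)$ (complex-valued) whose Fourier transform $\widehat{f}$ has compact support, there exists a real analytic function $h:\mathbb{R}^\ell\to\mathbb{C}$ such that $f(x)=h(\rho_1(x),\dots,\rho_\ell(x))$ for every $x\in\mathbb{R}^n$.
   Context: $K$ acts continuously on $\mathbb{R}^n$ through the orthogonal group $\mathrm{O}(n)$; $k\cdot x$ denotes the action. A function $f$ is $K$-invariant if $f(k\cdot x)=f(x)$ for all $k\in K$, $x\in\mathbb{R}^n$. $\mathcal{P}(\mathbb{R}^n)^K$ is the algebra of real $K$-invariant polynomials on $\mathbb{R}^n$; it is finitely generated (Hilbert). The Fourier transform is $\widehat{f}(\xi)=\int_{\mathbb{R}^n}f(x)e^{-i\langle x,\xi\rangle}\,dx$. An $L^1$ function with compactly supported Fourier transform agrees almost everywhere with a smooth function, and $f$ is identified with this smooth representative. A complex-valued function on $\mathbb{R}^\ell$ is real analytic if near each point it is the sum of a convergent power series with complex coefficients. *)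

(* Defs.v *)
From HB Require Import structures.
From mathcomp Require Import all_boot all_order all_algebra.
From mathcomp Require Import all_classical all_reals all_analysis.
From mathcomp Require Import complex.
From mathcomp.analysis.showcase Require Import summability.
(* Required but not imported: its notations clash with MathComp-Analysis. *)
From mathcomp Require mpoly.

Set Implicit Arguments.
Unset Strict Implicit.
Unset Printing Implicit Defensive.

Import Order.TTheory GRing.Theory Num.Theory.
Import numFieldTopology.Exports numFieldNormedType.Exports.

Local Open Scope classical_set_scope.
Local Open Scope ring_scope.
Local Open Scope complex_scope.

(* As for tuples in the library: the sigma-algebra generated by the coordinates,
   which for T := R is the Borel sigma-algebra of R^n. *)
Definition measure_rV_display : measure_display -> measure_display.
Proof. exact. Qed.

Section measurable_rV.
Context {d} {T : sigmaRingType d}.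
Variable n : nat.

Let coors : 'I_n -> 'rV[T]_n -> T := fun i x => x ord0 i.

Let rV_set0 : g_sigma_preimage coors set0.
Proof. exact: sigma_algebra0. Qed.

Let rV_setC A : g_sigma_preimage coors A -> g_sigma_preimage coors (~` A).
Proof. exact: sigma_algebraC. Qed.

Let rV_bigcup (F : _^nat) : (forall i, g_sigma_preimage coors (F i)) ->
  g_sigma_preimage coors (\bigcup_i (F i)).
Proof. exact: sigma_algebra_bigcup. Qed.

HB.instance Definition _ := @isMeasurable.Build (measure_rV_display d)
  'rV[T]_n (g_sigma_preimage coors) rV_set0 rV_setC rV_bigcup.

End measurable_rV.

Lemma measurable_coord d (T : sigmaRingType d) n (i : 'I_n) :
  measurable_fun [set: 'rV[T]_n] (fun x => x ord0 i).
Proof.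
move=> _ Y mY; rewrite setTI; apply: sub_sigma_algebra => /=.
rewrite -bigcup_seq/=; exists i => /=; first by rewrite mem_index_enum.
by exists Y => //; rewrite setTI.
Qed.

Lemma measurable_fun_rVP d d' (T : measurableType d) (T' : measurableType d')
    n (f : T -> 'rV[T']_n) :
  (forall i, measurable_fun [set: T] (fun x => f x ord0 i)) ->
  measurable_fun [set: T] f.
Proof.
move=> mf _ A mA; rewrite setTI.
have [C mC <-] : preimage_set_system setT f measurable (f @^-1` A).
  by exists A => //; rewrite setTI.
rewrite setTI.
suff : g_sigma_preimage (fun i (x : 'rV[T']_n) => x ord0 i) `<=`
    [set B | measurable (f @^-1` B)] by exact.
apply: smallest_sub.
  split => /=; first by rewrite preimage_set0.
    by move=> B mB; rewrite setTD preimage_setC; exact: measurableC.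
  by move=> F mF; rewrite preimage_bigcup; exact: bigcup_measurable.
rewrite -bigcup_seq; apply: bigcup_sub => i _ B [D mD <-] /=.
by rewrite setTI -[X in measurable X]setTI; exact: mf.
Qed.

Section lebesgue_rV.
Context {R : realType}.

(* lebesgue_measure lives on measurableTypeR R, an alias of R with its Borel
   sigma-algebra; 'rV[measurableTypeR R]_n is thus convertible to 'rV[R]_n. *)
Definition cons_rV n (p : measurableTypeR R * 'rV[measurableTypeR R]_n) :
  'rV[measurableTypeR R]_n.+1 := row_mx (p.1 : R)%:M (p.2 : 'rV[R]_n).

Definition uncons_rV n (x : 'rV[measurableTypeR R]_n.+1) :
    measurableTypeR R * 'rV[measurableTypeR R]_n :=
  (x ord0 ord0, rsubmx (x : 'rV[R]_(1 + n))).

Lemma cons_rVK n : cancel (@cons_rV n) (@uncons_rV n).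
Proof.
move=> [a v]; rewrite /uncons_rV /cons_rV /= (@row_mxKr R); congr pair.
transitivity (row_mx (a : R)%:M (v : 'rV[R]_n) ord0 (lshift n ord0)).
  by congr (row_mx _ _ _ _); exact: val_inj.
by rewrite row_mxEl mxE eqxx mulr1n.
Qed.

Lemma uncons_rVK n : cancel (@uncons_rV n) (@cons_rV n).
Proof.
move=> x; rewrite /cons_rV /= -[RHS](@hsubmxK R 1 1 n); apply: (congr2 (@row_mx R 1 1 n)) => //.
apply/rowP => j; rewrite !ord1 !mxE eqxx mulr1n; congr (x _ _); exact: val_inj.
Qed.

Lemma measurable_cons_rV n : measurable_fun setT (@cons_rV n).
Proof.
apply: measurable_fun_rVP => i; case: (split_ordP (i : 'I_(1 + n))) => j ->.
  apply: eq_measurable_fun measurable_fst => -[a v] _.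
  by apply/esym; apply: etrans (row_mxEl _ _ _ _) _; rewrite mxE !ord1.
apply: (eq_measurable_fun ((fun x : 'rV[measurableTypeR R]_n => x ord0 j) \o snd)).
  by move=> [a v] _; apply/esym; exact: row_mxEr.
by apply: measurableT_comp => //; exact: measurable_coord.
Qed.

Lemma measurable_uncons_rV n : measurable_fun setT (@uncons_rV n).
Proof.
apply: measurable_fun_pair; first exact: measurable_coord.
apply: measurable_fun_rVP => i.
apply: (eq_measurable_fun (fun x : 'rV[measurableTypeR R]_n.+1 =>
  x ord0 (rshift 1 i : 'I_n.+1))); last exact: measurable_coord.
by move=> x _; rewrite mxE.
Qed.

Section step.
Variables (n : nat)
  (mu : {sigma_finite_measure set 'rV[measurableTypeR R]_n -> \bar R}).

Definition lebesgue_rVS : set 'rV[measurableTypeR R]_n.+1 -> \bar R :=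
  pushforward (@lebesgue_measure R \x mu)%E (@cons_rV n).

Let lebesgue_rVS0 : lebesgue_rVS set0 = 0%E.
Proof. by rewrite /lebesgue_rVS /pushforward preimage_set0 measure0. Qed.

Let lebesgue_rVS_ge0 A : (0 <= lebesgue_rVS A)%E.
Proof. by rewrite /lebesgue_rVS /pushforward. Qed.

Let lebesgue_rVS_sigma_additive : semi_sigma_additive lebesgue_rVS.
Proof.
exact: (@measure_semi_sigma_additive _ _ _
  (measure_function_pushforward__canonical__measure_function_Measure
     (@lebesgue_measure R \x mu)%E (@measurable_cons_rV n))).
Qed.

HB.instance Definition _ := isMeasure.Build _ _ _ lebesgue_rVS
  lebesgue_rVS0 lebesgue_rVS_ge0 lebesgue_rVS_sigma_additive.

Let sigma_finite_lebesgue_rVS : sigma_finite setT lebesgue_rVS.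
Proof.
have /sigma_finiteP[F [FT ndF Foo]] := sigma_finiteT (@lebesgue_measure R).
have /sigma_finiteP[G [GT ndG Goo]] := sigma_finiteT mu.
exists (fun k => @uncons_rV n @^-1` (F k `*` G k)).
  rewrite -preimage_bigcup -(preimage_setT (@uncons_rV n)); congr (_ @^-1` _).
  rewrite -setXTT FT GT predeqE => -[x y]; split.
    move=> [/= [i _ Fix] [k _ Gky]]; exists (maxn i k) => //; split.
    - by move: x Fix; exact/subsetPset/ndF/leq_maxl.
    - by move: y Gky; exact/subsetPset/ndG/leq_maxr.
  by move=> [i _ []/= ? ?]; split; exists i.
move=> k; have [mF Fk] := Foo k; have [mG Gk] := Goo k; split.
  rewrite -[X in measurable X]setTI.
  by apply: measurable_uncons_rV => //; exact: measurableX.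
rewrite /lebesgue_rVS /pushforward -comp_preimage.
rewrite (_ : _ \o _ = id); last by apply/funext => p; exact: cons_rVK.
by rewrite preimage_id product_measure1E// lte_mul_pinfty// ge0_fin_numE.
Qed.

HB.instance Definition _ :=
  Measure_isSigmaFinite.Build _ _ _ lebesgue_rVS sigma_finite_lebesgue_rVS.

End step.

Fixpoint lebesgue_rV n :
    {sigma_finite_measure set 'rV[measurableTypeR R]_n -> \bar R} :=
  if n is m.+1 then lebesgue_rVS (lebesgue_rV m)
  else dirac ((0 : 'rV[R]_0) : 'rV[measurableTypeR R]_0).

End lebesgue_rV.

Section fourier.
Context {R : realType} {n : nat}.
Implicit Types (f : 'rV[R]_n -> R[i]) (x xi : 'rV[R]_n).

Definition complex_integrable f : Prop :=
  (lebesgue_rV n).-integrable setT (EFin \o (fun x => complex.Re (f x))) /\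
  (lebesgue_rV n).-integrable setT (EFin \o (fun x => complex.Im (f x))).

Definition complex_integral f : R[i] :=
  (\int[lebesgue_rV n]_x complex.Re (f x)) +i*
  (\int[lebesgue_rV n]_x complex.Im (f x)).

Definition dotp x xi : R := \sum_(i < n) x ord0 i * xi ord0 i.

Definition expi (t : R) : R[i] := cos t +i* sin t.

Definition fourier f xi : R[i] :=
  complex_integral (fun x => f x * expi (- dotp x xi)).

Definition compactly_supported f : Prop := compact (closure [set x | f x != 0]).

End fourier.

HB.mixin Record isTopologicalGroup K & Topological K & Group K := {
  mulg_continuous : continuous (fun p : K * K => (p.1 * p.2)%g);
  invg_continuous : continuous (fun k : K => k^-1%g)
}.

#[short(type="topologicalGroupType")]
HB.structure Definition TopologicalGroup :=
  {K of Topological K & Group K & isTopologicalGroup K}.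

Record orthogonal_action (R : realType) (K : topologicalGroupType) (n : nat)
    (act : K -> 'rV[R]_n -> 'rV[R]_n) : Prop := OrthogonalAction {
  act1 : forall x, act 1%g x = x;
  actM : forall k k' x, act (k * k')%g x = act k (act k' x);
  act_orthogonal : forall k, exists2 A : 'M[R]_n,
    A *m A^T = 1%:M & forall x, act k x = x *m A;
  act_continuous : continuous (fun p : K * 'rV[R]_n => act p.1 p.2)
}.

Definition invariant_fun (X Y K : Type) (act : K -> X -> X) (f : X -> Y) : Prop :=
  forall k x, f (act k x) = f x.

Definition polyfun (R : realType) n (p : mpoly.mpoly n R) (x : 'rV[R]_n) : R :=
  mpoly.meval (x ord0) p.

Definition generates_invariants (R : realType) (K : Type) n
    (act : K -> 'rV[R]_n -> 'rV[R]_n) l (rho : l.-tuple (mpoly.mpoly n R)) : Prop :=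
  (forall i : 'I_l, invariant_fun act (polyfun (tnth rho i))) /\
  (forall p : mpoly.mpoly n R, invariant_fun act (polyfun p) ->
     exists q : mpoly.mpoly l R, p = mpoly.comp_mpoly rho q).

Definition monomial (R : realType) l (m : {ffun 'I_l -> nat}) (v : 'rV[R]_l) : R :=
  \prod_(i < l) v ord0 i ^+ m i.

(* The power series is summed over finite sets of multi-indices ordered by
   inclusion; for complex families this is absolute convergence. *)
Definition real_analytic (R : realType) l (h : 'rV[R]_l -> R[i]) : Prop :=
  forall a : 'rV[R]_l, exists c : {ffun 'I_l -> nat} -> R[i],
    \forall y \near a,
      partial_sum (fun m => c m * (monomial m (y - a))%:C) @ totally -->
        (h y : R[i]^o).

(* Main.v *)
(* Write u for the real or the imaginary part of f.  Testing u against products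
   of triangle functions, which are the transforms of Fejer kernels, gives the
   inversion formula u(x) = c * int (C(xi) cos<x,xi> + S(xi) sin<x,xi>) dxi,
   where C and S are the cosine and sine transforms of u; by parity both are
   supported in a box.  Expanding cos and sin in power series yields
   u = sum_d P_d with P_d homogeneous of degree d and
   sum_d |P_d|_w < oo for every weighted l^1 norm |.|_w of the coefficients.
   Uniqueness of power series along rays makes each P_d invariant, so P_d lies
   in the subalgebra generated by rho.

   The point is to write P_d = q_d(rho) with control of the coefficients of
   q_d.  In R[x, z] take the ideal of polynomials vanishing under z := rho and
   the lexicographic order, where every x exceeds every z.  If F(x, z) is
   congruent to some polynomial q(z) but involves x, its leading monomial is
   that of F - q, hence divisible by the leading monomial of one of finitely
   many fixed elements of the ideal, and can be reduced; this ends with a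
   polynomial in z alone.  For weights w_t = (t^{W_i}) adapted to the order and t
   large, the leading term of each of these finitely many elements dominates its
   tail, so no reduction step increases the norm.  Hence
   |q_d|_t <= |P_d|_{t^M} for all large t, with M independent of d, so that
   h = sum_d q_d converges on the whole space together with all its
   re-expansions. *)
Require Import Defs.
From HB Require Import structures.
From mathcomp Require Import all_boot all_order all_algebra.
From mathcomp Require Import boolp.
From mathcomp Require ssrcomplements mpoly.

Set Implicit Arguments.
Unset Strict Implicit.
Unset Printing Implicit Defensive.

Import Order.TTheory GRing.Theory Num.Theory.

Local Open Scope ring_scope.

(** * Bounded elimination in polynomial rings *)

Module BoundedElimination.
Import ssrcomplements mpoly.

(** * Weighted l^1 norms of polynomial coefficients *)

Section WeightedNorm.
Variable R : realFieldType.

(** [mmap1 w m] is the product of the [w i ^+ m i]. For nonnegative [w] this is the norm of a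
    weighted l^1 algebra: it is submultiplicative and bounds [p] on the polydisc of radii [w]. *)
Definition wnorm n (w : 'I_n -> R) (p : {mpoly R[n]}) : R :=
  \sum_(m <- msupp p) `|p@_m| * mmap1 w m.

Variables (n : nat) (w : 'I_n -> R).
Hypothesis w_ge0 : forall i, 0 <= w i.
Implicit Types p q : {mpoly R[n]}.

Lemma mmap1_ge0 m : 0 <= mmap1 w m.
Proof. by apply: prodr_ge0 => i _; exact: exprn_ge0. Qed.

Lemma wnorm_ge0 p : 0 <= wnorm w p.
Proof. by apply: sumr_ge0 => m _; rewrite mulr_ge0 ?mmap1_ge0. Qed.

(** Summation over a support-independent index set lets several polynomials be compared coefficient
    by coefficient. *)
Lemma wnormwE k p : (msize p <= k)%N ->
  wnorm w p = \sum_(m : 'X_{1..n < k}) `|p@_m| * mmap1 w m.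
Proof.
move=> le_pk; pose I : subFinType _ := 'X_{1..n < k}.
rewrite /wnorm (big_mksub I) //=; first last.
- by move=> m /msize_mdeg_lt /leq_trans; apply.
- exact: msupp_uniq.
by rewrite big_rmcond //= => m /memN_msupp_eq0 ->; rewrite normr0 mul0r.
Qed.

Lemma wnormD p q : wnorm w (p + q) <= wnorm w p + wnorm w q.
Proof.
pose k := maxn (msize (p + q)) (maxn (msize p) (msize q)).
rewrite !(@wnormwE k) ?leq_max ?leqnn ?orbT// -big_split/=.
apply: ler_sum => m _; rewrite mcoeffD -mulrDl ler_wpM2r ?mmap1_ge0//.
exact: ler_normD.
Qed.

Lemma wnorm0 : wnorm w 0 = 0.
Proof. by rewrite /wnorm msupp0 big_nil. Qed.

Lemma wnormZX (c : R) m : wnorm w (c *: 'X_[m]) = `|c| * mmap1 w m.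
Proof.
have [->|c0] := eqVneq c 0; first by rewrite scale0r wnorm0 normr0 mul0r.
by rewrite /wnorm msuppMCX// big_seq1 mcoeffZ mcoeffX eqxx mulr1.
Qed.

Lemma wnormX m : wnorm w 'X_[m] = mmap1 w m.
Proof. by rewrite -['X_[m]]scale1r wnormZX normr1 mul1r. Qed.

Lemma wnorm_sum (I : Type) (r : seq I) (F : I -> {mpoly R[n]}) :
  wnorm w (\sum_(i <- r) F i) <= \sum_(i <- r) wnorm w (F i).
Proof.
elim/big_rec2: _ => [|i x p _ le_px]; first by rewrite wnorm0.
by apply: le_trans (wnormD _ _) _; rewrite lerD2l.
Qed.

Lemma wnormZ (c : R) p : wnorm w (c *: p) = `|c| * wnorm w p.
Proof.
rewrite !(@wnormwE (msize p)) ?msizeZ_le// mulr_sumr; apply: eq_bigr => m _.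
by rewrite mcoeffZ normrM mulrA.
Qed.

Lemma wnormN p : wnorm w (- p) = wnorm w p.
Proof. by rewrite -scaleN1r wnormZ normrN1 mul1r. Qed.

(** By the triangle inequality in both factors it is enough to multiply monomials, and there the
    weights multiply exactly. *)
Lemma wnormM p q : wnorm w (p * q) <= wnorm w p * wnorm w q.
Proof.
have wXM m : wnorm w ('X_[m] * q) <= mmap1 w m * wnorm w q.
  rewrite {1}[q]mpolyE mulr_sumr; apply: le_trans (wnorm_sum _ _) _.
  rewrite {2}/wnorm mulr_sumr; apply: ler_sum => m' _.
  rewrite -scalerAr -mpolyXD wnormZX mulrCA ler_wpM2l//.
  by rewrite commr_mmap1_M// => i x; exact: mulrC.
rewrite {1}[p]mpolyE mulr_suml; apply: le_trans (wnorm_sum _ _) _.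
rewrite {2}/wnorm mulr_suml; apply: ler_sum => m _.
by rewrite -scalerAl wnormZ -mulrA ler_wpM2l.
Qed.

Lemma wnorm1 : wnorm w 1 = 1.
Proof. by rewrite -mpolyX0 wnormX mmap11. Qed.

Lemma wnormXn p k : wnorm w (p ^+ k) <= wnorm w p ^+ k.
Proof.
elim: k => [|k IH]; first by rewrite !expr0 wnorm1.
rewrite !exprS; apply: le_trans (wnormM _ _) _.
by rewrite ler_wpM2l ?wnorm_ge0.
Qed.

Lemma wnorm_prod (I : Type) (r : seq I) (F : I -> {mpoly R[n]}) :
  wnorm w (\prod_(i <- r) F i) <= \prod_(i <- r) wnorm w (F i).
Proof.
elim/big_rec2: _ => [|i x p _ le_px]; first by rewrite wnorm1.
apply: le_trans (wnormM _ _) _; apply: ler_wpM2l le_px; exact: wnorm_ge0.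
Qed.

(** Being an equality, this tells exactly how much norm is freed when a leading term is
    cancelled. *)
Lemma wnorm_split p m : wnorm w p =
  `|p@_m| * mmap1 w m + wnorm w (p - p@_m *: 'X_[m]).
Proof.
pose k := maxn (mdeg m).+1 (maxn (msize p) (msize (p - p@_m *: 'X_[m]))).
have mk : (mdeg m < k)%N by rewrite leq_max leqnn.
rewrite !(@wnormwE k) ?leq_max ?leqnn ?orbT//.
rewrite (bigD1 (BMultinom mk))//= [in RHS](bigD1 (BMultinom mk))//=.
rewrite mcoeffB mcoeffZ mcoeffX eqxx mulr1 subrr normr0 mul0r add0r.
congr (_ + _); apply: eq_bigr => m' m'm.
rewrite mcoeffB mcoeffZ mcoeffX; case: eqP => [mm'|]; last by rewrite mulr0 subr0.
by case/eqP: m'm; apply/val_inj; rewrite /= mm'.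
Qed.

Lemma meval_le_wnorm p (v : 'I_n -> R) : (forall i, `|v i| <= w i) ->
  `|p.@[v]| <= wnorm w p.
Proof.
move=> vw; rewrite mevalE; apply: le_trans (ler_norm_sum _ _ _) _.
apply: ler_sum => m _; rewrite normrM ler_wpM2l// normr_prod.
by apply: ler_prod => i _; rewrite normr_ge0 normrX lerXn2r ?nnegrE.
Qed.

End WeightedNorm.

Lemma wnorm_le (R : realFieldType) n (w w' : 'I_n -> R) p :
  (forall i, 0 <= w i <= w' i) -> wnorm w p <= wnorm w' p.
Proof.
move=> ww'; apply: ler_sum => m _; rewrite ler_wpM2l//.
apply: ler_prod => i _; have /andP[w0 le] := ww' i.
by rewrite exprn_ge0//= lerXn2r ?nnegrE// (le_trans w0).
Qed.

(** Submultiplicativity bounds each substituted monomial by the same monomial in the norms of the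
    [lq], hence by its weight under [w]. *)
Lemma wnorm_comp (R : realFieldType) n k (w : 'I_n -> R) (v : 'I_k -> R)
    (lq : n.-tuple {mpoly R[k]}) p :
    (forall i, 0 <= v i) ->
    (forall i, wnorm v (tnth lq i) <= w i) ->
  wnorm v (p \mPo lq) <= wnorm w p.
Proof.
move=> v0 lqw; rewrite comp_mpolyE; apply: le_trans (wnorm_sum v0 _ _) _.
apply: ler_sum => m _; rewrite wnormZ// ler_wpM2l//.
apply: le_trans (wnorm_prod v0 _ _) _; apply: ler_prod => i _.
rewrite wnorm_ge0//=; apply: le_trans (wnormXn v0 _ _) _.
by rewrite lerXn2r ?nnegrE ?wnorm_ge0// (le_trans _ (lqw i))// wnorm_ge0.
Qed.

(** Only the monomials outside [S] survive in the difference. The bound is uniform in [S], as needed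
    for tails of series. *)
Lemma mevalB_sub_sum_le (R : realFieldType) n (w v : 'I_n -> R) (p : {mpoly R[n]})
    (S : seq 'X_{1..n}) : (forall i, `|v i| <= w i) -> uniq S ->
  `|p.@[v] - \sum_(m <- S) p@_m * mmap1 v m| <= wnorm w p.
Proof.
move=> vw S_uniq; rewrite mevalE (bigID (mem S))/=.
have -> : \sum_(m <- S) p@_m * mmap1 v m =
    \sum_(m <- msupp p | m \in S) p@_m * \prod_i v i ^+ m i.
  rewrite (bigID (mem (msupp p)))/= [X in _ + X]big1 ?addr0 => [|m]; last first.
    by move/memN_msupp_eq0 => ->; rewrite mul0r.
  rewrite -big_filter -[RHS]big_filter; apply/perm_big/uniq_perm;
    rewrite ?filter_uniq ?msupp_uniq// => m.
  by rewrite !mem_filter andbC.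
rewrite addrAC subrr add0r; apply: le_trans (ler_norm_sum _ _ _) _.
rewrite big_mkcond; apply: ler_sum => m _; case: ifP => _; last first.
  by rewrite mulr_ge0// mmap1_ge0// => i; exact: le_trans (vw i).
rewrite normrM ler_wpM2l// normr_prod.
by apply: ler_prod => i _; rewrite normr_ge0 normrX lerXn2r ?nnegrE ?(le_trans _ (vw i)).
Qed.

Lemma meval_sum_supp (R : realFieldType) n (v : 'I_n -> R) (p : {mpoly R[n]})
    (S : seq 'X_{1..n}) : uniq S -> {subset msupp p <= S} ->
  p.@[v] = \sum_(m <- S) p@_m * mmap1 v m.
Proof.
move=> S_uniq pS; rewrite mevalE [RHS](bigID (mem (msupp p)))/=.
rewrite [X in _ + X]big1 ?addr0 => [|m]; last first.
  by move/memN_msupp_eq0 => ->; rewrite mul0r.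
rewrite -[RHS]big_filter; apply/perm_big/uniq_perm;
  rewrite ?filter_uniq ?msupp_uniq// => m.
by rewrite mem_filter; case: (boolP (m \in msupp p)) => // /pS ->.
Qed.

Lemma mcoeff_le_wnorm (R : realFieldType) n (p : {mpoly R[n]}) m :
  `|p@_m| <= wnorm (fun=> 1) p.
Proof.
rewrite (wnorm_split _ p m) /mmap1 big1 => [|i _]; last by rewrite expr1n.
by rewrite mulr1 lerDl wnorm_ge0.
Qed.

(** Its coefficients are the Taylor coefficients of [p] at [a], from which the local power series
    are built. *)
Definition translate (R : realFieldType) n (a : 'I_n -> R) (p : {mpoly R[n]}) :
  {mpoly R[n]} := p \mPo [tuple 'X_i + (a i)%:MP | i < n].

Lemma meval_translate (R : realFieldType) n (a y : 'I_n -> R) p :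
  (translate a p).@[fun i => y i - a i] = p.@[y].
Proof.
rewrite comp_mpoly_meval; apply: meval_eq => i.
by rewrite tnth_mktuple mevalD mevalXU mevalC subrK.
Qed.

Lemma wnorm_translate (R : realFieldType) n (a w w' : 'I_n -> R) p :
  (forall i, 0 <= w i) -> (forall i, w i + `|a i| <= w' i) ->
  wnorm w (translate a p) <= wnorm w' p.
Proof.
move=> w0 ww'; apply: wnorm_comp => // i; apply: le_trans (ww' i).
rewrite tnth_mktuple; apply: le_trans (wnormD w0 _ _) _; rewrite lerD//.
  by rewrite wnormX mmap1U.
by rewrite -[_%:MP]mulr1 mul_mpolyC -mpolyX0 wnormZX mmap11 mulr1.
Qed.

Section TensorPolynomial.
Variables (R : realFieldType) (n d : nat) (M : {ffun 'I_d -> 'I_n} -> R).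

(** A form of degree [d] given by a tensor that need not be symmetric; several words [j] may yield
    the same monomial, so no multinomial coefficients appear. *)
Definition tensor_poly : {mpoly R[n]} := \sum_j M j *: \prod_(k < d) 'X_(j k).

Lemma meval_tensor_poly v : tensor_poly.@[v] = \sum_j M j * \prod_(k < d) v (j k).
Proof.
rewrite /tensor_poly (big_morph _ (mevalD v) (meval0 v)); apply: eq_bigr => j _.
rewrite mevalZ (big_morph _ (mevalM v) (meval1 v)); congr (_ * _).
by apply: eq_bigr => k _; rewrite mevalXU.
Qed.

Lemma wnorm_tensor_poly (r : R) : 0 <= r ->
  wnorm (fun=> r) tensor_poly <= \sum_j `|M j| * r ^+ d.
Proof.
move=> r0; apply: le_trans (wnorm_sum (fun=> r0) _ _) _.
apply: ler_sum => j _; rewrite wnormZ ler_wpM2l//.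
apply: le_trans (wnorm_prod (fun=> r0) _ _) _.
rewrite -[d in leRHS]card_ord -prodr_const; apply: ler_prod => k _.
by rewrite wnormX mmap1U r0 lexx.
Qed.

End TensorPolynomial.

(** Dickson's lemma, by induction on the number of coordinates. A finite set [B] good for the first
    [N] coordinates handles every element whose last coordinate is at least [bound]; each of the
    finitely many smaller values of that coordinate defines a slice, to which the induction
    hypothesis applies. *)
Lemma dickson (T : eqType) (N : nat) (c : nat -> T -> nat) (L : T -> Prop) :
  exists2 B : seq T, (forall b, b \in B -> L b) &
    forall a, L a -> exists2 b, b \in B & forall i, (i < N)%N -> (c i b <= c i a)%N.
Proof.
elim: N L => [|N IH] L.
  have [[a La]|nL] := pselect (exists a, L a); last first.
    by exists [::] => // a La; case: nL; exists a.
  by exists [:: a] => [b|a' _]; [rewrite inE => /eqP->|exists a; rewrite ?inE].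
have [B BL LB] := IH L.
pose bound := (\max_(b <- B) c N b)%N.
have /choice[S SP] k : exists S : seq T, (forall b, b \in S -> L b) /\
    forall a, L a -> c N a = k -> exists2 b, b \in S &
      forall i, (i < N.+1)%N -> (c i b <= c i a)%N.
  have [S SL LS] := IH (fun a => L a /\ c N a = k).
  exists S; split=> [b /SL[]//|a La cak].
  have [b bS ba] := LS a (conj La cak); exists b => // i.
  rewrite ltnS leq_eqVlt => /predU1P[->|/ba//].
  by have [_ ->] := SL b bS; rewrite cak.
exists (B ++ flatten [seq S k | k <- iota 0 bound]) => [b|a La].
  rewrite mem_cat => /orP[/BL//|/flatten_mapP[k _ bS]].
  by have [SL _] := SP k; exact: SL.
have [le_a|lt_a] := leqP bound (c N a).
  have [b bB ba] := LB a La; exists b; first by rewrite mem_cat bB.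
  move=> i; rewrite ltnS leq_eqVlt => /predU1P[->|/ba//].
  by apply: leq_trans le_a; exact: leq_bigmax_seq.
have [_ /(_ a La erefl)[b bS ba]] := SP (c N a); exists b => //.
rewrite mem_cat; apply/orP; right; apply/flatten_mapP.
by exists (c N a); rewrite ?mem_iota.
Qed.

(** * The lexicographic order on exponents and weights adapted to it *)

Section LexOrder.
Variable N : nat.
Implicit Types m : 'X_{1..N}.

Import DefaultTupleLexiOrder.

Definition lexlt m1 m2 := (multinom_val m1 < multinom_val m2)%O.

Lemma lexltP m1 m2 : reflect
  (exists2 k : 'I_N, forall i : 'I_N, (i < k)%N -> m1 i = m2 i & (m1 k < m2 k)%N)
  (lexlt m1 m2).
Proof. exact: ltxi_tuplePlt. Qed.

Lemma lexlt_wf (P : 'X_{1..N} -> Prop) :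
  (forall m, (forall m', lexlt m' m -> P m') -> P m) -> forall m, P m.
Proof.
move=> ih m; have [t {m}->] : exists t, m = Multinom t by case: m => t; exists t.
elim/(@ltxwf _ nat): t => [Q {}ih k|t IH]; last first.
  by apply: ih => -[t'] /IH.
(* What remains is well-founded induction on [nat] for the individual exponents, proved by induction
   on a strict upper bound. *)
elim: {k}k.+1 {-2}k (leqnn k.+1) => [//|k IHk] j jk.
apply: ih => i; rewrite ltEnat /= => ij; apply: IHk.
by rewrite ltnS in jk; exact: leq_trans ij jk.
Qed.

Lemma lexlt_add m m1 m2 : lexlt m1 m2 -> lexlt (m + m1)%MM (m + m2)%MM.
Proof.
move=> /lexltP[k lt_k k12]; apply/lexltP; exists k => [i /lt_k ik|];
  by rewrite !mnmDE ?ik ?ltn_add2l.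
Qed.

Lemma lexlt_irr m : lexlt m m = false.
Proof. by rewrite /lexlt ltxx. Qed.

Lemma lexlt_trans m2 m1 m3 : lexlt m1 m2 -> lexlt m2 m3 -> lexlt m1 m3.
Proof. exact: lt_trans. Qed.

Lemma lexlt_total m1 m2 : m1 != m2 -> lexlt m1 m2 || lexlt m2 m1.
Proof.
move=> m12; rewrite /lexlt -neq_lt; apply: contra m12 => /eqP m12.
by apply/eqP/val_inj.
Qed.

Definition is_lead (R : realFieldType) (F : {mpoly R[N]}) m :=
  m \in msupp F /\ forall m', m' \in msupp F -> m' != m -> lexlt m' m.

Lemma ex_lead (R : realFieldType) (F : {mpoly R[N]}) :
  F != 0 -> exists m, is_lead F m.
Proof.
rewrite -msupp_eq0 /is_lead; elim: (msupp F) => [//|a [|b s] IH] _.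
  exists a; rewrite inE eqxx; split=> // m'; rewrite inE => /eqP->.
  by rewrite eqxx.
have {IH}[//|m [ms mP]] := IH.
have [am|am] := boolP (lexlt m a).
  exists a; rewrite inE eqxx; split=> // m'; rewrite inE => /predU1P[->|m's _].
    by rewrite eqxx.
  have [->//|m'm] := eqVneq m' m.
  exact: lexlt_trans (mP _ m's m'm) am.
exists m; rewrite inE ms orbT; split=> // m'; rewrite inE => /predU1P[->|m's].
  by move=> /lexlt_total; rewrite (negbTE am) orbF.
exact: mP.
Qed.

Definition wdeg (W : 'I_N -> nat) m := (\sum_i m i * W i)%N.

Lemma wdegD W m1 m2 : wdeg W (m1 + m2)%MM = (wdeg W m1 + wdeg W m2)%N.
Proof.
by rewrite /wdeg -big_split/=; apply: eq_bigr => i _; rewrite mnmDE mulnDl.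
Qed.

(* Exponents below [B] are compared lexicographically by reading them as digits
   in base [B]. *)
Lemma wdeg_lexlt B m1 m2 : (mdeg m1 < B)%N -> lexlt m1 m2 ->
  (wdeg (fun i : 'I_N => B ^ (N - i)) m1 < wdeg (fun i : 'I_N => B ^ (N - i)) m2)%N.
Proof.
move=> mB /lexltP[k eq_k lt_k]; rewrite /wdeg.
rewrite (bigID (fun i : 'I_N => (i < k)%N))/= [ltnRHS](bigID (fun i : 'I_N => (i < k)%N))/=.
rewrite (eq_bigr (fun i : 'I_N => m2 i * B ^ (N - i))%N) => [|i /eq_k->//].
rewrite ltn_add2l (bigD1 k) ?ltnn//= [ltnRHS](bigD1 k) ?ltnn//=.
have B0 : (0 < B)%N by exact: leq_ltn_trans mB.
apply: leq_trans (leq_addr _ _).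
apply: (@leq_trans ((m1 k).+1 * B ^ (N - k))); last by rewrite leq_pmul2r ?expn_gt0 ?B0.
rewrite mulSn addnC -addSn leq_add2r.
have -> : (N - k = (N - k.+1).+1)%N by rewrite subnSK.
(* The digits after position [k] have place value at most [B ^ (N - k.+1)] and add up to at most
   [mdeg m1 < B], so together they stay below one unit of digit [k]. *)
rewrite expnS; apply: (@leq_ltn_trans (mdeg m1 * B ^ (N - k.+1))); last first.
  by rewrite ltn_pmul2r ?expn_gt0 ?B0.
rewrite mdegE big_distrl/= big_mkcond/=; apply: leq_sum => i _.
case: ifP => // /andP[]; rewrite -leqNgt leq_eqVlt => /predU1P[/val_inj->|ki _].
  by rewrite eqxx.
rewrite leq_mul2l; apply/orP; right; apply: leq_pexp2l => //.
by apply: leq_sub2l.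
Qed.

End LexOrder.

(** * Leading monomials of an ideal and reduction that does not increase the norm *)

Section Reduction.
Variables (R : realFieldType) (N : nat) (I : {mpoly R[N]} -> Prop).
Hypothesis I_add : forall p q, I p -> I q -> I (p + q).
Hypothesis I_mul : forall p q, I p -> I (q * p).
Implicit Types (F G p q : {mpoly R[N]}) (m b : 'X_{1..N}).

(** Dickson's lemma, applied to the set of leading exponents, selects finitely many that divide all
    others; each is realised by an element scaled to be monic. *)
Lemma groebner_basis : exists Gs : seq ({mpoly R[N]} * 'X_{1..N}),
  (forall G b, (G, b) \in Gs -> [/\ I G, is_lead G b & G@_b = 1]) /\
  (forall F m, I F -> is_lead F m ->
     exists G b, (G, b) \in Gs /\ (b <= m)%MM).
Proof.
pose L m := exists2 F, I F & is_lead F m.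
pose c i m := nth 0%N m i.
have [B BL LB] := @dickson _ N c L.
(* The choice function must be total; at exponents that lead no element of [I] it takes the dummy
   value 0. *)
have /choice[g gP] b : exists G, L b -> [/\ I G, is_lead G b & G@_b = 1].
  have [[F IF [bF leadF]]|nLb] := pselect (L b); last by exists 0.
  have Fb0 : F@_b != 0 by rewrite -mcoeff_msupp.
  exists ((F@_b)^-1 *: F) => _; split.
  - by rewrite -mul_mpolyC; exact: I_mul.
  - split; first by rewrite mcoeff_msupp mcoeffZ mulVf// oner_neq0.
    by move=> m' /msuppZ_le; exact: leadF.
  - by rewrite mcoeffZ mulVf.
exists [seq (g b, b) | b <- B]; split=> [G b|F m IF Fm].
  by move=> /mapP[b' /BL Lb [-> ->]]; exact: gP.
have [|b bB bm] := LB m; first by exists F.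
exists (g b), b; split; first exact: map_f.
by apply/mnm_lepP => i; rewrite !(mnm_nth 0%N); exact: bm.
Qed.

Lemma mmap1_expn (t : R) (W : 'I_N -> nat) m :
  mmap1 (fun i => t ^+ W i) m = t ^+ wdeg W m.
Proof.
rewrite /mmap1 /wdeg -prodrXr; apply: eq_bigr => i _.
by rewrite -exprM mulnC.
Qed.

(** With a base [B] above all degrees involved, [wdeg_lexlt] gives each tail monomial a strictly
    smaller weighted degree than the leading one. The tail thus loses at least one factor [t], which
    pays for its coefficients once [t] is large. *)
Lemma dominating_weights (Gs : seq ({mpoly R[N]} * 'X_{1..N})) :
    (forall G b, (G, b) \in Gs -> is_lead G b /\ G@_b = 1) ->
  exists W : 'I_N -> nat, exists t0 : R,
    [/\ forall i, (0 < W i)%N, 1 <= t0 &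
     forall t, t0 <= t -> forall G b, (G, b) \in Gs ->
       wnorm (fun i => t ^+ W i) (G - 'X_[b]) <= t ^+ wdeg W b].
Proof.
move=> GsP.
pose B := (\max_(Gb <- Gs) msize Gb.1).+1.
pose coefs G := \sum_(m <- msupp G) `|G@_m|.
have coefs0 G : 0 <= coefs G by exact: sumr_ge0.
pose W (i : 'I_N) := (B ^ (N - i))%N.
(* The summand 1 makes powers of [t] nondecreasing in the exponent; the sum dominates the
   coefficient mass of every single tail. *)
exists W, (1 + \sum_(Gb <- Gs) coefs (Gb.1 - 'X_[Gb.2])).
split=> [i||t le_t G b Gb]; first by rewrite expn_gt0.
  by rewrite lerDl sumr_ge0.
have t1 : 1 <= t by apply: le_trans le_t; rewrite lerDl sumr_ge0.
have [[bG leadG] Gb1] := GsP _ _ Gb.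
have tail_lt m : m \in msupp (G - 'X_[b]) -> (wdeg W m < wdeg W b)%N.
  rewrite mcoeff_msupp mcoeffB mcoeffX.
  have [<-|mb] := eqVneq b m; first by rewrite Gb1 subrr eqxx.
  rewrite subr0 -mcoeff_msupp => mG; apply: wdeg_lexlt.
    rewrite ltnS; apply: leq_trans (ltnW (msize_mdeg_lt mG)) _.
    exact: (@leq_bigmax_seq _ Gs xpredT (fun Gb => msize Gb.1) _ Gb).
  by apply: leadG; rewrite // eq_sym.
have [->|/ex_lead[m0 [m0G _]]] := eqVneq (G - 'X_[b]) 0.
  by rewrite wnorm0 exprn_ge0// (le_trans ler01).
(* A nonzero tail forces this degree to be positive, so that passing to its predecessor really
   removes a factor [t]. *)
have bW : (0 < wdeg W b)%N by exact: leq_ltn_trans (tail_lt _ m0G).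
apply: (@le_trans _ _ (coefs (G - 'X_[b]) * t ^+ (wdeg W b).-1)).
  rewrite /wnorm /coefs mulr_suml big_seq [leRHS]big_seq; apply: ler_sum => m mG.
  rewrite ler_wpM2l// mmap1_expn; apply: ler_weXn2l => //.
  by rewrite -ltnS prednK// tail_lt.
rewrite -[in leRHS](prednK bW) exprS; apply: ler_wpM2r.
  by rewrite exprn_ge0// (le_trans ler01).
apply: le_trans le_t; apply: ler_wpDl => //.
rewrite (big_rem _ Gb)/= lerDl; exact: sumr_ge0.
Qed.

Variables (Gs : seq ({mpoly R[N]} * 'X_{1..N})) (W : 'I_N -> nat) (t0 : R).
Hypothesis GsI : forall G b, (G, b) \in Gs -> [/\ I G, is_lead G b & G@_b = 1].
Hypothesis Gs_basis : forall F m, I F -> is_lead F m ->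
  exists G b, (G, b) \in Gs /\ (b <= m)%MM.
Hypothesis t0_ge1 : 1 <= t0.
Hypothesis Gs_dom : forall t, t0 <= t -> forall G b, (G, b) \in Gs ->
  wnorm (fun i => t ^+ W i) (G - 'X_[b]) <= t ^+ wdeg W b.
Variable low : pred 'X_{1..N}.
Hypothesis low_elim : forall m m', low m' -> ~~ low m -> lexlt m' m.

(** Induction on the leading exponent of [F]. If it is not low, it is also the leading exponent of
    [F - q], so some basis element can cancel it, and by [Gs_dom] the tail brought in costs no more
    than the term removed. The reduction steps do not involve [t], hence one [F'] serves all
    [t >= t0]. *)
Lemma bounded_elimination F q :
  (forall m, m \in msupp q -> low m) -> I (F - q) ->
  exists F', [/\ forall m, m \in msupp F' -> low m, I (F - F') &
    forall t, t0 <= t ->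
      wnorm (fun i => t ^+ W i) F' <= wnorm (fun i => t ^+ W i) F].
Proof.
move=> q_low; have [-> IFq|/ex_lead[m]] := eqVneq F 0.
  exists 0; split=> // [m|]; first by rewrite msupp0.
  (* Membership of 0 in [I] comes from writing it as 0 times a known member. *)
  by rewrite subrr -(mul0r (0 - q)); exact: I_mul.
elim/lexlt_wf: m F => m IH F [mF leadF] IFq.
have [m_low|m_nlow] := boolP (low m).
  (* Once the leading exponent is low, all exponents of [F] are: one that is not low would lie above
     it by [low_elim]. *)
  exists F; split=> // [m' m'F|]; last first.
    by rewrite subrr -(mul0r (F - q)); exact: I_mul.
  have [->//|m'm] := eqVneq m' m; apply: contraT => /(low_elim m_low) mm'.
  by have := lexlt_trans mm' (leadF _ m'F m'm); rewrite lexlt_irr.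
(* [q] is low, so it cannot cancel the leading term of [F]. *)
have mq : m \notin msupp q by apply: contra m_nlow; exact: q_low.
have [G [b [Gb bm]]] : exists G b, (G, b) \in Gs /\ (b <= m)%MM.
  apply: Gs_basis IFq _; split.
    by rewrite mcoeff_msupp mcoeffB (memN_msupp_eq0 mq) subr0 -mcoeff_msupp.
  move=> m' /msuppB_le; rewrite mem_cat => /orP[/leadF//|/q_low m'_low _].
  exact: low_elim.
have [IG [bG leadG] Gb1] := GsI Gb.
pose c := F@_m; pose H := (c *: 'X_[(m - b)%MM]) * G; pose F1 := F - H.
have IH' : I H by exact: I_mul.
have HE m' : H@_m' = c * ('X_[(m - b)%MM] * G)@_m' by rewrite /H -scalerAl mcoeffZ.
have Hm : H@_m = c.
  have := mcoeffMX G (m - b)%MM b.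
  by rewrite submK// Gb1 HE ['X_[_] * G]mulrC => ->; rewrite mulr1.
have leadH m' : m' \in msupp H -> m' != m -> lexlt m' m.
  rewrite /H -scalerAl => /msuppZ_le; rewrite mulrC (perm_mem (msuppMX _ _)).
  move=> /mapP[g gG ->]; have := submK bm; set k := (m - b)%MM => <-.
  by rewrite eqm_add2l => gb; apply: lexlt_add; exact: leadG.
have norm_le t : t0 <= t ->
    wnorm (fun i => t ^+ W i) F1 <= wnorm (fun i => t ^+ W i) F.
  move=> le_t; have t_ge0 : 0 <= t by rewrite (le_trans ler01)// (le_trans t0_ge1).
  have w_ge0 i : 0 <= t ^+ W i by exact: exprn_ge0.
  (* The leading term of [F] is exchanged for a monomial multiple of the tail of [G]; [wnorm_split]
     credits the former against the latter. *)
  have -> : F1 = (F - c *: 'X_[m]) - c *: ('X_[(m - b)%MM] * (G - 'X_[b])).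
    by rewrite mulrBr -mpolyXD submK// scalerBr opprB addrA subrK scalerAl.
  rewrite (wnorm_split _ F m) -/c [leRHS]addrC; apply: le_trans (wnormD w_ge0 _ _) _.
  rewrite wnormN wnormZ lerD2l ler_wpM2l//.
  apply: le_trans (wnormM w_ge0 _ _) _; rewrite wnormX mmap1_expn.
  rewrite mmap1_expn -{2}(submK bm) wdegD exprD ler_wpM2l ?exprn_ge0//.
  exact: Gs_dom.
have IF1q : I (F1 - q) by rewrite /F1 addrAC -[- H]mulN1r; apply: I_add (I_mul _ _).
have IFF1 F' : I (F1 - F') -> I (F - F').
  by move=> IF1; rewrite -[F](subrK H) -/F1 addrAC; exact: I_add.
have [F10|/ex_lead[m1 [m1F1 leadF1]]] := eqVneq F1 0.
  exists 0; split=> [m'|//|t le_t]; first by rewrite msupp0.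
    by apply: IFF1; rewrite F10 subrr -(mul0r H); exact: I_mul.
  by rewrite -F10; exact: norm_le.
have m1m : lexlt m1 m.
  have m1m : m1 != m.
    by apply: contraTneq m1F1 => ->; rewrite mcoeff_msupp mcoeffB Hm subrr eqxx.
  by have := msuppB_le m1F1; rewrite mem_cat => /orP[/leadF|/leadH]; exact.
have [F' [F'low IF' F'le]] := IH m1 m1m F1 (conj m1F1 leadF1) IF1q.
exists F'; split=> // [|t le_t]; first exact: IFF1.
by apply: le_trans (norm_le _ le_t); exact: F'le.
Qed.

End Reduction.

Lemma comp_mpoly_sum (R : comNzRingType) n k (lq : n.-tuple {mpoly R[k]}) (T : Type)
    (r : seq T) (F : T -> {mpoly R[n]}) :
  (\sum_(i <- r) F i) \mPo lq = \sum_(i <- r) (F i \mPo lq).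
Proof.
apply: (big_morph (comp_mpoly lq)); [exact: comp_mpolyD|exact: comp_mpoly0].
Qed.

(** * Rewriting a polynomial in the generators with control of its coefficients *)

Section BoundedSection.
Variables (R : realFieldType) (n l : nat) (rho : l.-tuple {mpoly R[n]}).

(** The substitution fixing the [n] variables x and sending the [l] variables z to [rho]; its kernel
    is the ideal of relations. *)
Let eval_z : (n + l).-tuple {mpoly R[n]} :=
  [tuple match split i with inl j => 'X_j | inr j => tnth rho j end | i < n + l].

Let eval_zl i : tnth eval_z (lshift l i) = 'X_i.
Proof. by rewrite tnth_mktuple -[lshift l i]/(unsplit (inl i)) unsplitK. Qed.

Let eval_zr i : tnth eval_z (rshift n i) = tnth rho i.
Proof. by rewrite tnth_mktuple -[rshift n i]/(unsplit (inr i)) unsplitK. Qed.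

Let low (m : 'X_{1..n + l}) := [forall i : 'I_n, m (lshift l i) == 0%N].

(** The x variables carry the smaller indices, so the first x exponent that is nonzero in [m]
    decides the comparison. *)
Let low_elim m m' : low m' -> ~~ low m -> lexlt m' m.
Proof.
move=> /forallP m'0 /forallPn[i0 mi0].
pose i := [arg min_(i < i0 | m (lshift l i) != 0%N) i : nat].
have [{}i mi min_i] : extremum_spec leq [pred i : 'I_n | m (lshift l i) != 0%N] val i.
  by rewrite /i; case: arg_minnP => // j mj minj; split.
apply/lexltP; exists (lshift l i) => [j|]; last by rewrite (eqP (m'0 i)) lt0n.
case: (split_ordP j) => k -> /= ki; last by rewrite ltnNge ltnW// ltn_addr in ki.
rewrite (eqP (m'0 k)); apply/esym/eqP; apply: contraLR ki => mk.
by rewrite -leqNgt; exact: min_i.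
Qed.

Let inl_mnm (m : 'X_{1..n}) : 'X_{1..n + l} :=
  [multinom (if split i is inl j then m j else 0%N) | i < n + l].
Let inr_mnm (m : 'X_{1..l}) : 'X_{1..n + l} :=
  [multinom (if split i is inr j then m j else 0%N) | i < n + l].
Let prr_mnm (m : 'X_{1..n + l}) : 'X_{1..l} := [multinom m (rshift n j) | j < l].

Let inl_mnml m i : inl_mnm m (lshift l i) = m i.
Proof. by rewrite mnmE -[lshift l i]/(unsplit (inl i)) unsplitK. Qed.
Let inl_mnmr m i : inl_mnm m (rshift n i) = 0%N.
Proof. by rewrite mnmE -[rshift n i]/(unsplit (inr i)) unsplitK. Qed.
Let inr_mnml m i : inr_mnm m (lshift l i) = 0%N.
Proof. by rewrite mnmE -[lshift l i]/(unsplit (inl i)) unsplitK. Qed.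
Let inr_mnmr m i : inr_mnm m (rshift n i) = m i.
Proof. by rewrite mnmE -[rshift n i]/(unsplit (inr i)) unsplitK. Qed.

(** Written in x, the polynomial [q \mPo rho] becomes [F]; written in z, [q] becomes [Q]. Both have
    the same image under [eval_z], so [F] can be reduced to a polynomial in z alone. The basis and
    its weights depend only on [rho], and so do [M] and [t0]. *)
Lemma bounded_section : exists M : nat, exists2 t0 : R, 1 <= t0 &
  forall q : {mpoly R[l]}, exists2 q' : {mpoly R[l]}, q' \mPo rho = q \mPo rho &
    forall t, t0 <= t -> wnorm (fun=> t) q' <= wnorm (fun=> t ^+ M) (q \mPo rho).
Proof.
pose I (F : {mpoly R[n + l]}) := F \mPo eval_z = 0.
have I_add p q : I p -> I q -> I (p + q) by rewrite /I comp_mpolyD => -> ->; rewrite addr0.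
have I_mul p q : I p -> I (q * p) by rewrite /I rmorphM/= => ->; rewrite mulr0.
have [Gs [GsI Gs_basis]] := groebner_basis I_mul.
have [|W [t0 [W_gt0 t0_ge1 Gs_dom]]] := @dominating_weights R _ Gs.
  by move=> G b /GsI[].
(* With [M] the largest weight exponent, the x variables weigh at most [t ^+ M]; since all exponents
   are positive, the z variables weigh at least [t]. *)
exists (\max_i W i)%N, t0 => // q; set p := q \mPo rho.
pose F := \sum_(m <- msupp p) p@_m *: 'X_[R, inl_mnm m].
pose Q := \sum_(m <- msupp q) q@_m *: 'X_[R, inr_mnm m].
have Fp : F \mPo eval_z = p.
  rewrite [RHS]mpolyE; apply: etrans (comp_mpoly_sum _ _ _) _; apply: eq_bigr => m _.
  rewrite comp_mpolyZ comp_mpolyX big_split_ord/= [X in _ * X]big1.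
    rewrite mulr1 mpolyXE_id; congr (_ *: _); apply: eq_bigr => i _.
    by rewrite eval_zl inl_mnml.
  by move=> i _; rewrite inl_mnmr expr0.
have Qp : Q \mPo eval_z = p.
  rewrite [RHS]comp_mpolyE; apply: etrans (comp_mpoly_sum _ _ _) _; apply: eq_bigr => m _.
  rewrite comp_mpolyZ comp_mpolyX big_split_ord/= [X in X * _]big1.
    rewrite mul1r; congr (_ *: _); apply: eq_bigr => i _.
    by rewrite eval_zr inr_mnmr.
  by move=> i _; rewrite inr_mnml expr0.
have [m mQ||F' [F'low IF' F'le]] :=
  bounded_elimination I_add I_mul GsI Gs_basis t0_ge1 Gs_dom low_elim (F := F) (q := Q).
- have := msupp_sum_le mQ; rewrite filter_predT => /flatten_mapP[k _].
  move=> /msuppZ_le; rewrite msuppX inE => /eqP->.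
  by apply/forallP => i; rewrite inr_mnml.
- by rewrite /I comp_mpolyB Fp Qp subrr.
exists (\sum_(m <- msupp F') F'@_m *: 'X_[prr_mnm m]).
  apply: etrans (comp_mpoly_sum _ _ _) _; transitivity (F' \mPo eval_z).
    rewrite [in RHS]comp_mpolyE big_seq [RHS]big_seq; apply: eq_bigr => m /F'low/forallP mlow.
    rewrite comp_mpolyZ comp_mpolyX big_split_ord/= [X in _ = _ *: (X * _)]big1.
      rewrite mul1r; congr (_ *: _); apply: eq_bigr => i _.
      by rewrite eval_zr mnmE.
    by move=> i _; rewrite (eqP (mlow i)) expr0.
  by move: IF'; rewrite /I comp_mpolyB Fp => /eqP; rewrite subr_eq0 => /eqP.
move=> t le_t; have t1 : 1 <= t := le_trans t0_ge1 le_t.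
have t_ge0 : 0 <= t := le_trans ler01 t1.
have w_ge0 i : 0 <= t ^+ W i by exact: exprn_ge0.
apply: (@le_trans _ _ (wnorm (fun i => t ^+ W i) F')).
  apply: le_trans (wnorm_sum (fun=> t_ge0) _ _) _.
  rewrite /wnorm big_seq [leRHS]big_seq; apply: ler_sum => m /F'low/forallP mlow.
  rewrite -/(wnorm _ _) wnormZX ler_wpM2l// /mmap1 big_split_ord/=.
  rewrite [X in _ <= X * _]big1 => [|i _].
    rewrite mul1r; apply: ler_prod => i _; rewrite exprn_ge0//= mnmE.
    by rewrite -exprM; apply: ler_weXn2l => //; rewrite leq_pmull.
  by rewrite (eqP (mlow i)) expr0.
apply: le_trans (F'le t le_t) _.
apply: le_trans (wnorm_sum w_ge0 _ _) _; apply: ler_sum => m _.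
rewrite -/(wnorm _ _) wnormZX ler_wpM2l// /mmap1 big_split_ord/= [X in _ * X]big1 => [|i _].
  rewrite mulr1; apply: ler_prod => i _; rewrite exprn_ge0//= inl_mnml.
  rewrite lerXn2r ?nnegrE ?exprn_ge0//; apply: ler_weXn2l => //.
  exact: (leq_bigmax (lshift l i)).
by rewrite inl_mnmr expr0.
Qed.

End BoundedSection.

End BoundedElimination.

From mathcomp Require Import all_classical all_reals all_analysis.
From mathcomp Require Import measurable_realfun finmap ring lra.
From mathcomp Require Import complex.
From mathcomp.analysis.showcase Require Import summability.

Import numFieldTopology.Exports numFieldNormedType.Exports.
Import -(notations,coercions) mpoly.
Import BoundedElimination.

Local Open Scope classical_set_scope.

(** * Series of polynomials converging on the whole space *)

Lemma series_dominated (R : realType) (f g : R^nat) :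
  (forall k, `|f k| <= g k) -> cvgn (series g) -> cvgn (series f).
Proof.
move=> fg cg; apply: normed_cvg; apply: series_le_cvg cg => //= k.
exact: le_trans (fg k).
Qed.

Lemma series_le_lim (R : realType) (f : R^nat) N : (forall k, 0 <= f k) ->
  cvgn (series f) -> series f N <= limn (series f).
Proof.
move=> f0 cf; apply: nondecreasing_cvgn_le => // i j ij.
by rewrite /series/= [leRHS](big_cat_nat (leq0n i) ij)//= lerDl sumr_ge0.
Qed.

Section EntireSeries.
Variables (R : realType) (n : nat).
Implicit Types (q : (mpoly.mpoly n R)^nat) (v : 'I_n -> R).

(** Coefficient norms are summed instead of values, so that the double series over [d] and monomials
    converges absolutely and may be regrouped by exponent or recentred. *)
Definition entire q := forall r : R, 0 <= r ->
  cvgn (series (fun d => wnorm (fun=> r) (q d))).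

Definition entire_sum q v : R := limn (series (fun d => mpoly.meval v (q d))).

Definition entire_coef q m : R := limn (series (fun d => mpoly.mcoeff m (q d))).

Lemma entire_cvg q v : entire q -> cvgn (series (fun d => mpoly.meval v (q d))).
Proof.
move=> eq; pose r := \sum_i `|v i|.
apply: series_dominated (eq r _) => [d|]; last exact: sumr_ge0.
apply: meval_le_wnorm => i; first exact: sumr_ge0.
by rewrite /r (bigD1 i)//= lerDl sumr_ge0.
Qed.

Lemma entire_coef_cvg q m : entire q ->
  cvgn (series (fun d => mpoly.mcoeff m (q d))).
Proof.
by move=> eq; apply: series_dominated (eq 1 _) => // d; exact: mcoeff_le_wnorm.
Qed.

(** [S0] collects the monomials of the first [D] terms, which then contribute no error; the later
    terms contribute at most the tail of the norm series, whatever [S] contains. *)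
Lemma entire_finite_sums q v (e : R) : entire q -> 0 < e ->
  exists S0 : seq (mpoly.multinom n), 
    forall S : seq (mpoly.multinom n), uniq S -> {subset S0 <= S} ->
    `|\sum_(m <- S) entire_coef q m * mpoly.mmap1 v m - entire_sum q v| <= e.
Proof.
move=> eq e0; pose r := \sum_i `|v i|.
have vr i : `|v i| <= r by rewrite /r (bigD1 i)//= lerDl sumr_ge0.
have r0 : 0 <= r by exact: sumr_ge0.
have cw := eq r r0; set w := fun d => wnorm (fun=> r) (q d) in cw.
have w0 d : 0 <= w d by exact: wnorm_ge0.
have /cvgrPdist_le/(_ _ e0)[D _ Dw] := cw.
exists (flatten [seq mpoly.msupp (q d) | d <- iota 0 D]) => S S_uniq S0S.
pose t d := \sum_(m <- S) mpoly.mcoeff m (q d) * mpoly.mmap1 v m.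
have t_coef : series t @ \oo --> \sum_(m <- S) entire_coef q m * mpoly.mmap1 v m.
  rewrite (_ : series t = fun k => \sum_(m <- S)
      series (fun d => mpoly.mcoeff m (q d)) k * mpoly.mmap1 v m).
    apply: cvg_big => [|m _]; first exact: add_continuous.
    by apply: cvgM; [exact: entire_coef_cvg|exact: cvg_cst].
  apply/funext => k; rewrite /series/= exchange_big/=; apply: eq_bigr => m _.
  by rewrite mulr_suml.
have dcvg : (fun k => `|series t k - series (fun d => mpoly.meval v (q d)) k|) @ \oo -->
    `|\sum_(m <- S) entire_coef q m * mpoly.mmap1 v m - entire_sum q v|.
  by apply: cvg_norm; apply: cvgB => //; exact: entire_cvg.
apply: cvgr_to_le dcvg _; near=> k.
have Dk : (D <= k)%N by near: k; exact: nbhs_infty_ge.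
rewrite /series/= -sumrB (big_cat_nat _ Dk)//= [X in `|X + _|]big_nat_cond big1 ?add0r.
  apply: le_trans (ler_norm_sum _ _ _) _.
  apply: (@le_trans _ _ (\sum_(D <= d < k) w d)).
    apply: ler_sum => d _; rewrite distrC.
    exact: mevalB_sub_sum_le.
  rewrite (_ : \sum_(D <= d < k) w d = series w k - series w D); last first.
    by rewrite /series/= [X in _ = X - _](big_cat_nat (leq0n D) Dk)//= addrAC subrr add0r.
  apply: le_trans (Dw D (leqnn D)); apply: le_trans (ler_norm _).
  by rewrite lerD2r; exact: series_le_lim.
move=> d /andP[/andP[_ dD] _].
rewrite (@meval_sum_supp _ _ _ _ S)// ?subrr// => m mq; apply: S0S.
by apply/flatten_mapP; exists d; rewrite ?mem_iota.
Unshelve. all: by end_near.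
Qed.

(** Recentring enlarges the radius [r] by at most the l^1 norm of [a], and every radius is
    admissible. *)
Lemma entire_translate q (a : 'I_n -> R) : entire q ->
  entire (fun d => translate a (q d)).
Proof.
move=> eq r r0; have s0 : 0 <= r + \sum_i `|a i| by rewrite addr_ge0 ?sumr_ge0.
apply: series_dominated (eq _ s0) => d; rewrite ger0_norm; last exact: wnorm_ge0.
apply: wnorm_translate => // i.
by rewrite lerD2l (bigD1 i)//= lerDl sumr_ge0.
Qed.

Lemma entire_sum_translate q (a y : 'I_n -> R) :
  entire_sum (fun d => translate a (q d)) (fun i => y i - a i) = entire_sum q y.
Proof.
by congr (limn (series _)); apply/funext => d; exact: meval_translate.
Qed.

End EntireSeries.

(** * From entire series to real analytic functions *)

Section RealAnalytic.
Local Open Scope complex_scope.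
Variables (R : realType) (l : nat).

Lemma normc_le (a b : R) : `|a +i* b| <= (`|a| + `|b|)%:C.
Proof.
rewrite normc_def lecR/= -[leRHS]ger0_norm ?addr_ge0// -sqrtr_sqr ler_sqrt ?sqr_ge0//.
rewrite sqrrD !real_normK ?num_real// -addrA lerD2l lerDr.
by rewrite mulrn_wge0// mulr_ge0.
Qed.

Lemma mulc_real (a b c : R) : (a +i* b) * c%:C = (a * c) +i* (b * c).
Proof. by apply/eqP; rewrite eq_complex/= !mulr0 subr0 add0r !eqxx. Qed.

(** The coefficients at [a] are those of the two recentred series; [entire_finite_sums] is exactly
    convergence along the filter [totally], up to translating multinomials into finite functions. *)
Lemma entire_real_analytic (q1 q2 : (mpoly.mpoly l R)^nat) : entire q1 -> entire q2 ->
  real_analytic (fun y : 'rV[R]_l =>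
    entire_sum q1 (y ord0) +i* entire_sum q2 (y ord0)).
Proof.
move=> eq1 eq2 a.
pose mn (m : {ffun 'I_l -> nat}) : mpoly.multinom l := mpoly.Multinom [tuple m i | i < l].
pose t (q : (mpoly.mpoly l R)^nat) d := translate (a ord0) (q d).
exists (fun m => entire_coef (t q1) (mn m) +i* entire_coef (t q2) (mn m)).
near=> y.
have FF := @totally_filter {ffun 'I_l -> nat}.
(* A positive element of [R[i]] is real; half of it is allotted to the real part and half to the
   imaginary part. *)
apply/(@cvgrPdist_le R[i] R[i]^o) => e; rewrite ltcE/= => /andP[/eqP Ime e0].
have e20 : 0 < complex.Re e / 2 by rewrite divr_gt0.
pose z i := y ord0 i - a ord0 i.
have [S1 S1P] := entire_finite_sums z (entire_translate (a := a ord0) eq1) e20.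
have [S2 S2P] := entire_finite_sums z (entire_translate (a := a ord0) eq2) e20.
have mn_inj : injective mn.
  move=> m m' /(congr1 (fun k => mpoly.multinom_val k)) mm'; apply/ffunP => i.
  by have := congr1 (fun k => tnth k i) mm'; rewrite !tnth_mktuple.
pose inv (k : mpoly.multinom l) : {ffun 'I_l -> nat} :=
  [ffun i => tnth (mpoly.multinom_val k) i].
have inv_mn : cancel inv mn.
  by move=> k; apply/val_inj/eq_from_tnth => i; rewrite tnth_mktuple ffunE.
exists [fset inv k | k in S1 ++ S2]%fset => // S /fsubsetP S12.
have mapS (k : mpoly.multinom l) : k \in S1 ++ S2 -> k \in [seq mn m | m <- S].
  by move=> kS; rewrite -(inv_mn k) map_f//; apply: S12; exact: in_imfset.
have monomialE m : monomial m (y - a) = mpoly.mmap1 z (mn m).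
  apply: eq_bigr => i _; rewrite !mxE; congr (_ ^+ _).
  by rewrite /mpoly.fun_of_multinom tnth_mktuple.
have sumE (F1 F2 : {ffun 'I_l -> nat} -> R) (s : seq {ffun 'I_l -> nat}) :
    \sum_(i <- s) (F1 i +i* F2 i) = (\sum_(i <- s) F1 i) +i* (\sum_(i <- s) F2 i).
  elim: s => [|m s IH]; first by rewrite !big_nil.
  by rewrite !big_cons IH.
have -> : partial_sum (fun m => (entire_coef (t q1) (mn m) +i* entire_coef (t q2) (mn m)) *
      (monomial m (y - a))%:C) S =
    (\sum_(k <- [seq mn m | m <- S]) entire_coef (t q1) k *
        mpoly.mmap1 z k) +i*
    (\sum_(k <- [seq mn m | m <- S]) entire_coef (t q2) k *
        mpoly.mmap1 z k).
  apply: etrans (esym (big_seq_fsetE _ S xpredT _)) _.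
  have bm (G : mpoly.multinom l -> R) :
      \sum_(k <- [seq mn m | m <- S]) G k = \sum_(m <- S) G (mn m).
    exact: big_map.
  apply: etrans _ (congr2 (@Complex R) (esym (bm _)) (esym (bm _))).
  apply: etrans (sumE _ _ _).
  apply: eq_bigr => m _.
  by rewrite monomialE mulc_real.
have S_uniq : uniq [seq mn m | m <- S] by rewrite map_inj_uniq ?fset_uniq.
apply: le_trans (normc_le _ _) _.
have -> : e = (complex.Re e)%:C by apply/eqP; rewrite eq_complex/= Ime !eqxx.
rewrite lecR [leRHS]splitr; apply: lerD.
  rewrite distrC -(entire_sum_translate q1 (a ord0)).
  by apply: S1P => // k kS; apply: mapS; rewrite mem_cat kS.
rewrite distrC -(entire_sum_translate q2 (a ord0)).
by apply: S2P => // k kS; apply: mapS; rewrite mem_cat kS orbT.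
Unshelve. all: by end_near.
Qed.

End RealAnalytic.

(** Strong induction on the index [m]: once the lower coefficients vanish, division of the series by
    [t ^+ m] leaves [|a m| <= t * M] for [0 < t <= 1], and [t] can be taken arbitrarily small. *)
Lemma power_series_eq0 (R : realType) (a : R^nat) :
  cvgn (series (fun d => `|a d|)) ->
  (forall t, 0 < t <= 1 -> series (fun d => a d * t ^+ d) @ \oo --> 0) ->
  forall d, a d = 0.
Proof.
move=> ca a0; elim/ltn_ind => m IH.
set M := limn (series (fun d => `|a d|)).
have M0 : 0 <= M.
  apply: (@le_trans _ _ (series (fun d => `|a d|) 0)); first by rewrite /series/= big_geq.
  exact: series_le_lim.
have am t : 0 < t <= 1 -> `|a m| <= t * M.
  move=> /andP[t0 t1]; rewrite -(ler_pM2r (exprn_gt0 m t0)) mulrAC -exprS.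
  have cvg1 : (fun N => `|a m * t ^+ m| - `|series (fun d => a d * t ^+ d) N|) @ \oo -->
      `|a m * t ^+ m| - `|0 : R|.
    by apply: cvgB; [exact: cvg_cst|apply: cvg_norm; apply: a0; rewrite t0].
  rewrite normr0 subr0 normrM (ger0_norm (exprn_ge0 m (ltW t0))) in cvg1.
  apply: cvgr_to_le cvg1 _; near=> N.
  have mN : (m < N)%N by near: N; exact: nbhs_infty_gt.
  rewrite /series/= (big_cat_nat (leq0n m) (ltnW mN))//=.
  rewrite [X in `|X + _|]big_nat_cond [X in `|X + _|]big1 ?add0r; last first.
    by move=> i /andP[/andP[_ im] _]; rewrite IH// mul0r.
  rewrite big_ltn//; set T := (X in `|_ + X|).
  apply: (@le_trans _ _ `|T|).
    have := ler_normB (a m * t ^+ m + T) T.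
    by rewrite addrK lerBlDl normrM (ger0_norm (exprn_ge0 m (ltW t0))).
  apply: le_trans (ler_norm_sum _ _ _) _.
  apply: (@le_trans _ _ (\sum_(m.+1 <= i < N) t ^+ m.+1 * `|a i|)).
    rewrite big_nat_cond [leRHS]big_nat_cond; apply: ler_sum => i /andP[/andP[mi _] _].
    rewrite normrM mulrC ler_wpM2r// ger0_norm ?exprn_ge0 ?(ltW t0)//.
    by apply: ler_wiXn2l => //; rewrite ltW.
  rewrite -mulr_sumr; apply: ler_wpM2l; first by rewrite exprn_ge0// ltW.
  apply: le_trans (series_le_lim N _ ca) => //.
  by rewrite /series/= [leRHS](big_cat_nat (leq0n m.+1) mN)//= lerDr sumr_ge0.
apply/eqP; rewrite -normr_le0; apply/ler_addgt0Pl => e e0; rewrite addr0.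
have M1 : 0 < M + 1 by rewrite ltr_wpDl.
(* Chosen so that [t <= 1] and [t * M <= e]; the denominator is [M + 1] because [M] may be 0. *)
pose t := Num.min 1 (e / (M + 1)).
have t01 : 0 < t <= 1 by rewrite lt_min ltr01 divr_gt0//= ge_min lexx.
apply: le_trans (am t t01) _.
apply: (@le_trans _ _ (e / (M + 1) * (M + 1))).
  apply: ler_pM => //; first by case/andP: t01 => /ltW.
    by rewrite ge_min lexx orbT.
  by rewrite lerDl.
by rewrite divfK// gt_eqF.
Unshelve. all: by end_near.
Qed.

(** * Invariance of the homogeneous parts and passage to the generators *)

Section Invariants.
Variables (R : realType) (n : nat).

Definition homogeneous d (p : mpoly.mpoly n R) := forall (t : R) (v : 'I_n -> R),
  mpoly.meval (fun i => t * v i) p = t ^+ d * mpoly.meval v p.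

(** Along the rays through [x] and [y] the sums are power series in [t] whose coefficients are the
    values of [P d] at [x] and [y]; uniqueness of coefficients separates the degrees. *)
Lemma entire_sum_invariant (P : (mpoly.mpoly n R)^nat) (x y : 'I_n -> R) :
  entire P -> (forall d, homogeneous d (P d)) ->
  (forall t, entire_sum P (fun i => t * x i) = entire_sum P (fun i => t * y i)) ->
  forall d, mpoly.meval x (P d) = mpoly.meval y (P d).
Proof.
move=> eP hP Pxy d; apply/eqP; rewrite -subr_eq0; apply/eqP; move: d.
apply: power_series_eq0 => [|t t01].
  pose r := \sum_i `|x i| + \sum_i `|y i|.
  have r0 : 0 <= r by rewrite addr_ge0// sumr_ge0.
  have cw := is_cvg_seriesD (eP r r0) (eP r r0).
  apply: series_dominated cw => d /=; rewrite normr_id.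
  apply: le_trans (ler_normB _ _) _; rewrite lerD//; apply: meval_le_wnorm => // i.
    by rewrite /r (bigD1 i)//= -addrA lerDl addr_ge0 ?sumr_ge0.
  by rewrite /r addrC (bigD1 i)//= -addrA lerDl addr_ge0 ?sumr_ge0.
rewrite -(subrr (entire_sum P (fun i => t * y i))) -{1}Pxy.
rewrite (_ : series _ = fun N => series (fun d => mpoly.meval (fun i => t * x i) (P d)) N -
    series (fun d => mpoly.meval (fun i => t * y i) (P d)) N).
  by apply: cvgB; exact: entire_cvg.
apply/funext => N; rewrite /series/= -sumrB; apply: eq_bigr => d _.
by rewrite !hP -mulrBr mulrC.
Qed.

(** The exponent [M] and threshold [t0] of [bounded_section] are the same for every [d], so
    convergence for [P] at radius [t ^+ M] gives convergence for [q] at radius [t]. *)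
Lemma entire_sum_comp l (rho : l.-tuple (mpoly.mpoly n R)) (P : (mpoly.mpoly n R)^nat) :
  entire P -> (forall d, exists q, P d = mpoly.comp_mpoly rho q) ->
  exists2 q : (mpoly.mpoly l R)^nat, entire q &
    forall v, entire_sum P v = entire_sum q (fun j => mpoly.meval v (tnth rho j)).
Proof.
move=> eP PE; have [M [t0 t01 Mt0]] := bounded_section rho.
have /choice[q qP] d : exists q, P d = mpoly.comp_mpoly rho q /\
    forall t, t0 <= t -> wnorm (fun=> t) q <= wnorm (fun=> t ^+ M) (P d).
  have [q0 Pd] := PE d; have [q qq0 qle] := Mt0 q0.
  by exists q; rewrite Pd -qq0; split=> //; rewrite qq0.
exists q => [r r0|v]; last first.
  congr (limn (series _)); apply/funext => d; have [-> _] := qP d.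
  exact: comp_mpoly_meval.
(* The estimate starts at [t0]; smaller radii follow by monotonicity of the norm in the weights. *)
pose t := Num.max r t0.
have t_ge0 : 0 <= t by rewrite le_max r0.
apply: series_dominated (eP (t ^+ M) (exprn_ge0 _ t_ge0)) => d.
rewrite ger0_norm; last exact: wnorm_ge0.
have [_ /(_ t)] := qP d; rewrite le_max lexx orbT => /(_ isT); apply: le_trans.
by apply: wnorm_le => i; rewrite r0 le_max lexx.
Qed.

End Invariants.

(** The action is linear and so commutes with scaling; invariance of [u] therefore holds along whole
    rays and passes to each [P d], which is then a polynomial in [rho]. *)
Lemma invariant_entire_comp (R : realType) (K : topologicalGroupType) (n l : nat)
    (act : K -> 'rV[R]_n -> 'rV[R]_n) (rho : l.-tuple (mpoly.mpoly n R))
    (P : (mpoly.mpoly n R)^nat) (u : 'rV[R]_n -> R) :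
  orthogonal_action act -> generates_invariants act rho ->
  entire P -> (forall d, homogeneous d (P d)) ->
  (forall x, u x = entire_sum P (x ord0)) -> invariant_fun act u ->
  exists2 q : (mpoly.mpoly l R)^nat, entire q &
    forall x, u x = entire_sum q ((\row_(j < l) polyfun (tnth rho j) x) ord0).
Proof.
move=> actP [_ rho_gen] eP hP uP u_inv.
have [d|q eq Pq] := entire_sum_comp (rho := rho) eP.
  apply: rho_gen => k x; apply: entire_sum_invariant eP hP _ d => t.
  transitivity (u (t *: act k x)).
    by rewrite uP; congr entire_sum; apply/funext => i; rewrite mxE.
  have -> : t *: act k x = act k (t *: x).
    by have [A _ AP] := act_orthogonal actP k; rewrite !AP scalemxAl.
  by rewrite u_inv uP; congr entire_sum; apply/funext => i; rewrite mxE.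
exists q => // x; rewrite uP Pq; congr entire_sum.
by apply/funext => j; rewrite mxE.
Qed.

(** * The Fejer kernel on the line *)

Section AffineChange.
Variable R : realType.
Local Notation lam := (@lebesgue_measure R).

(** The image of Lebesgue measure under the affine map, multiplied by [|a|], agrees with Lebesgue
    measure on half-open intervals, hence everywhere by uniqueness. *)
Lemma lebesgue_affine (a b : R) (f : measurableTypeR R -> \bar R) : a != 0 ->
  measurable_fun setT f -> (forall x, (0 <= f x)%E) ->
  (\int[lam]_x f x = `|a|%:E * \int[lam]_x f (a * x + b)%R)%E.
Proof.
move=> a0 mf f0.
pose phi (x : measurableTypeR R) : measurableTypeR R := a * x + b.
have mphi : measurable_fun setT phi.
  by apply: measurable_funD => //; apply: measurable_funM.
pose mu := mscale (NngNum (normr_ge0 a)) 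
  (measure_function_pushforward__canonical__measure_function_Measure lam mphi).
transitivity (\int[mu]_x f x)%E.
  apply: eq_measure_integral => A mA _; apply: lebesgue_measure_unique mA => X /ocitvP[->|].
    by rewrite !measure0.
  move=> [[c d]/= cd ->]; rewrite lebesgue_measure_itv/= lte_fin cd.
  rewrite /mu /mscale/= /pushforward.
  have [a_lt0|a_gt0|a_eq0] := ltgtP a 0; last by rewrite a_eq0 eqxx in a0.
    (* A negative slope reverses the interval, which moves the closed end to the left. *)
    rewrite (_ : phi @^-1` _ = `[(d - b) / a, (c - b) / a[%classic); last first.
      apply/seteqP; split=> x /=; rewrite !in_itv/= /phi ler_ndivrMr// ltr_ndivlMr//;
        by rewrite ltrBlDr lerBrDr mulrC => /andP[-> ->].
    rewrite lebesgue_measure_itv/= lte_fin.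
    rewrite ltr_nM2r ?invr_lt0// ltrD2r cd -EFinB -EFinB -EFinM; congr EFin.
    by rewrite ltr0_norm// -mulrBl; field.
  rewrite (_ : phi @^-1` _ = `](c - b) / a, (d - b) / a]%classic); last first.
    apply/seteqP; split=> x /=; rewrite !in_itv/= /phi ltr_pdivrMr// ler_pdivlMr//;
      by rewrite ltrBlDr lerBrDr mulrC => /andP[-> ->].
  rewrite lebesgue_measure_itv/= lte_fin.
  rewrite ltr_pM2r ?invr_gt0// ltrD2r cd -EFinB -EFinB -EFinM; congr EFin.
  by rewrite gtr0_norm// -mulrBl; field.
rewrite ge0_integral_mscale//=; congr (_ * _)%E.
by rewrite ge0_integral_pushforward.
Qed.

End AffineChange.

(** * The kernel (1 - cos(ax))/x^2 and its triangular cosine transform *)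

Section FejerKernel.
Variable R : realType.
Local Notation lam := (@lebesgue_measure R).
Implicit Types a e t x : R.

Lemma normr_sin_le x : `|sin x| <= `|x|.
Proof.
wlog x0 : x / 0 <= x => [hw|].
  have [/hw//|/ltW x0] := leP 0 x.
  by rewrite -normrN -sinN -(normrN x); apply: hw; rewrite oppr_ge0.
have [|y _ yP] := @MVT_segment R sin cos 0 x x0 (fun y _ => is_derive_sin y).
  by apply: continuous_subspaceT => y; exact: continuous_sin.
rewrite sin0 !subr0 in yP; rewrite yP normrM -[leRHS]mul1r ler_wpM2r//.
exact: cos_max.
Qed.

Lemma oneB_cosE x : 1 - cos x = (sin (x / 2)) ^+ 2 *+ 2.
Proof.
rewrite [in LHS](splitr x) -mulr2n cos_mulr2n cos2sin2; ring.
Qed.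

Lemma oneB_cos_ge0 x : 0 <= 1 - cos x.
Proof. by rewrite subr_ge0 cos_le1. Qed.

Lemma oneB_cos_le x : 1 - cos x <= x ^+ 2 / 2.
Proof.
rewrite oneB_cosE -[sin _ ^+ 2]real_normK ?num_real//.
have le2 : `|sin (x / 2)| ^+ 2 <= `|x / 2| ^+ 2 by rewrite lerXn2r ?nnegrE// normr_sin_le.
rewrite (@le_trans _ _ (`|x / 2| ^+ 2 *+ 2)) ?lerMn2r ?le2//.
by rewrite real_normK ?num_real// le_eqVlt; apply/orP; left; apply/eqP; field.
Qed.

(* With this value at [0], [fejer_scale] and [fejer_cosE] hold at [x = 0] too. *)
Definition fejer a x : R := if x == 0 then a ^+ 2 / 2 else (1 - cos (a * x)) / x ^+ 2.

Lemma fejer_ge0 a x : 0 <= fejer a x.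
Proof.
rewrite /fejer; case: eqP => _; first by rewrite divr_ge0 ?sqr_ge0.
by rewrite divr_ge0 ?sqr_ge0// oneB_cos_ge0.
Qed.

Lemma fejer_le a x : fejer a x <= a ^+ 2 / 2.
Proof.
rewrite /fejer; case: eqVneq => // x0.
by rewrite ler_pdivrMr ?exprn_even_gt0// mulrAC -exprMn oneB_cos_le.
Qed.

Lemma fejer_scale a x : a != 0 -> fejer a x = a ^+ 2 * fejer 1 (a * x).
Proof.
move=> a0; rewrite /fejer mulf_eq0 (negbTE a0)/=; case: eqVneq => x0.
  by rewrite expr1n mulrA mulr1.
by rewrite mul1r; field; apply/andP.
Qed.

Lemma measurable_fejer a : measurable_fun [set: measurableTypeR R] (fejer a).
Proof.
apply: measurable_fun_ifT.
- by apply: measurable_fun_eqr.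
- exact: measurable_cst.
- apply: measurable_funM.
    apply: measurable_funB; first exact: measurable_cst.
    apply: measurableT_comp; first by apply: continuous_measurable_fun; exact: continuous_cos.
    exact: measurable_funM.
  (* On nonnegative reals the inverse is the real power with exponent -1, whose measurability is
     available on the whole line. *)
  rewrite (_ : (fun x => (x ^+ 2)^-1) = (@powR R ^~ (-1)) \o (fun x => x ^+ 2)).
    by apply: measurableT_comp; [exact: measurable_powR|exact: measurable_funX].
  by apply/funext => x /=; rewrite powR_inv1 ?sqr_ge0.
Qed.

(** Comparison with the integrable function 1/(1+x^2): the kernel is at most 1/2 for [|x| <= 1] and
    at most 2/x^2 beyond. *)
Lemma fejer1_le x : fejer 1 x <= 4 * (oneDsqr x)^-1.
Proof.
have d0 : 0 < oneDsqr x by rewrite /oneDsqr ltr_pwDl ?sqr_ge0.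
have [x1|x1] := leP (x ^+ 2) 1.
  apply: le_trans (fejer_le 1 x) _; rewrite ler_pdivlMr// /oneDsqr; lra.
have x20 : 0 < x ^+ 2 by rewrite (lt_trans _ x1).
have x0 : x != 0 by apply: contraTneq x20 => ->; rewrite expr0n ltxx.
rewrite /fejer (negbTE x0) mul1r ler_pdivrMr// mulrAC ler_pdivlMr// /oneDsqr.
have := cos_geN1 x; have := cos_le1 x; nra.
Qed.


Lemma oneDsqr_gt0 x : 0 < oneDsqr x.
Proof. by rewrite /oneDsqr ltr_pwDl ?sqr_ge0. Qed.

Lemma continuous_oneDsqrV : continuous (fun x => (oneDsqr x)^-1).
Proof.
move=> x; apply: (@continuous_comp _ _ _ oneDsqr (@GRing.inv R)).
  by apply: cvgD; [exact: cvg_cst|exact: exprn_continuous].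
by apply: inv_continuous; rewrite gt_eqF ?oneDsqr_gt0.
Qed.

Lemma measurable_oneDsqrV : measurable_fun [set: measurableTypeR R] (fun x => (oneDsqr x)^-1).
Proof. by apply: continuous_measurable_fun; exact: continuous_oneDsqrV. Qed.

Lemma integral_oneDsqrV : (\int[lam]_x ((oneDsqr x)^-1)%:E = pi%:E)%E.
Proof.
rewrite ge0_symfun_integralT.
- rewrite (_ : [set x | _] = `[0, +oo[%classic).
    by rewrite integral0y_oneDsqr -EFinM mulrCA mulfV ?mulr1.
  by apply/seteqP; split=> x /=; rewrite in_itv/= andbT.
- by move=> x; rewrite invr_ge0 ltW ?oneDsqr_gt0.
- exact: continuous_oneDsqrV.
- by move=> x /=; rewrite /oneDsqr sqrrN.
Qed.


Lemma measurable_fejerE a : measurable_fun [set: measurableTypeR R] (EFin \o fejer a).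
Proof. by apply/measurable_EFinP; exact: measurable_fejer. Qed.

Lemma fejer0 x : fejer 0 x = 0.
Proof. by rewrite /fejer mul0r cos0 subrr mul0r expr0n mul0r if_same. Qed.

Lemma integral_fejer_scale a :
  (\int[lam]_x (fejer a x)%:E = `|a|%:E * \int[lam]_x (fejer 1 x)%:E)%E.
Proof.
have [->|a0] := eqVneq a 0.
  by rewrite normr0 mul0e; under eq_integral do rewrite fejer0; rewrite integral0.
have av0 : a^-1 != 0 by rewrite invr_eq0.
have f0 x : (0 <= (fejer a x)%:E)%E by rewrite lee_fin fejer_ge0.
rewrite (lebesgue_affine 0 av0 (measurable_fejerE a) f0).
under eq_integral do rewrite /= addr0 fejer_scale// mulrA mulfV// mul1r EFinM.
rewrite ge0_integralZl//; last 3 first.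
- exact: measurable_fejerE.
- by move=> x _; rewrite lee_fin fejer_ge0.
- by rewrite lee_fin sqr_ge0.
rewrite muleA -EFinM; congr (_%:E * _)%E.
by rewrite -[a ^+ 2]real_normK ?num_real// normfV expr2 mulKf ?normr_eq0.
Qed.

Lemma integral_fejer1_lty : (\int[lam]_x (fejer 1 x)%:E < +oo)%E.
Proof.
apply: (@le_lt_trans _ _ (\int[lam]_x (4 * (oneDsqr x)^-1)%:E)%E).
  apply: ge0_le_integral => //.
  - by move=> x _; rewrite lee_fin fejer_ge0.
  - exact: measurable_fejerE.
  - by apply/measurable_EFinP/measurable_funM => //; exact: measurable_oneDsqrV.
  - by move=> x _; rewrite lee_fin fejer1_le.
under eq_integral do rewrite EFinM.
rewrite ge0_integralZl//; first by rewrite integral_oneDsqrV -EFinM ltry.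
  by apply/measurable_EFinP; exact: measurable_oneDsqrV.
Qed.

Lemma integrable_fejer a : lam.-integrable setT (EFin \o fejer a).
Proof.
apply/integrableP; split; first exact: measurable_fejerE.
under eq_integral do rewrite /= ger0_norm ?fejer_ge0//.
by rewrite integral_fejer_scale lte_mul_pinfty// integral_fejer1_lty.
Qed.

Definition fejer_mass : R := \int[lam]_x fejer 1 x.

Lemma integral_fejer a : \int[lam]_x fejer a x = `|a| * fejer_mass.
Proof.
rewrite /Rintegral integral_fejer_scale fineM//.
exact: integrable_fin_num (integrable_fejer 1).
Qed.

(** On the interval from pi/2 to pi the cosine is nonpositive, so the kernel is at least 1/pi^2
    there. *)
Lemma fejer_mass_gt0 : 0 < fejer_mass.
Proof.
have pi0 := @pi_gt0 R.
rewrite -lte_fin /fejer_mass /Rintegral fineK; last first.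
  exact: integrable_fin_num (integrable_fejer 1).
have c0 : 0 < pi ^- 2 :> R by rewrite invr_gt0 exprn_gt0.
apply: (@lt_le_trans _ _ (\int[lam]_(x in `[(pi / 2)%R, (pi : R)]) (pi ^- 2)%R%:E)%E).
  rewrite integral_cst//= lebesgue_measure_itv/= lte_fin ltr_pdivrMr// ltr_pMr// ltr1n.
  by rewrite -EFinB -EFinM lte_fin mulr_gt0// subr_gt0 ltr_pdivrMr// ltr_pMr// ltr1n.
apply: (@le_trans _ _ (\int[lam]_(x in `[(pi / 2)%R, (pi : R)]) (fejer 1 x)%:E)%E).
  apply: ge0_le_integral => //=.
  - by move=> x _; rewrite lee_fin ltW.
  - exact: measurable_funTS (measurable_fejerE 1).
  - move=> x; rewrite in_itv/= => /andP[xge xle]; rewrite lee_fin.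
    have x0 : 0 < x by apply: lt_le_trans xge; rewrite divr_gt0.
    rewrite /fejer gt_eqF// mul1r ler_pdivlMr ?exprn_gt0// mulrC ler_pdivrMr ?exprn_gt0//.
    have cosx : cos x <= 0.
      rewrite -(subrK (pi / 2) x) cosDpihalf oppr_le0 sin_ge0_pi//.
      by rewrite subr_ge0 xge/= lerBlDr ler_wpDr// divr_ge0// ltW.
    apply: (@le_trans _ _ (pi ^+ 2)); first by rewrite lerXn2r ?nnegrE ?(ltW x0) ?(ltW pi0).
    by rewrite ler_peMl ?sqr_ge0// lerDl oppr_ge0.
apply: ge0_subset_integral => //; first exact: measurable_fejerE.
by move=> x _; rewrite lee_fin fejer_ge0.
Qed.

(** This is 2 cos(tx) cos(ex) = cos((t+e)x) + cos((t-e)x), divided by 2x^2. *)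
Lemma fejer_cosE e t x :
  fejer e x * cos (t * x) = (fejer (t + e) x + fejer (t - e) x) / 2 - fejer t x.
Proof.
rewrite /fejer; have [->|x0] := eqVneq x 0; first by rewrite mulr0 cos0; field.
by rewrite [(t + e) * x]mulrDl [(t - e) * x]mulrBl cosD cosB; field.
Qed.

(** The triangle function max(0, |e| - |t|), in the form produced by [fejer_cosE]. *)
Definition tent e t : R := (`|t + e| + `|t - e|) / 2 - `|t|.

Lemma integrable_fejerM e (h : R -> R) : measurable_fun [set: measurableTypeR R] h ->
  (forall x, `|h x| <= 1) -> lam.-integrable setT (EFin \o (fun x => fejer e x * h x)).
Proof.
move=> mh h1; apply: le_integrable (integrable_fejer e) => //=.
  by apply/measurable_EFinP/measurable_funM => //; exact: measurable_fejer.
move=> x _; rewrite lee_fin normrM (ger0_norm (fejer_ge0 _ _)).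
by rewrite ler_piMr ?fejer_ge0.
Qed.

(* [fejer_cosE] reduces the integral to those of [fejer a], which scale like
   [`|a|]; the value of [fejer_mass] is irrelevant. *)
Lemma integral_fejer_cos e t :
  \int[lam]_x (fejer e x * cos (t * x)) = fejer_mass * tent e t.
Proof.
under eq_Rintegral do rewrite fejer_cosE.
have i1 := integrable_fejer (t + e); have i2 := integrable_fejer (t - e).
have i12 : lam.-integrable setT (EFin \o (fun x => fejer (t + e) x + fejer (t - e) x)).
  exact: (integrableD measurableT i1 i2).
rewrite RintegralB//; last 2 first.
- exact: (integrableZr measurableT 2^-1 i12).
- exact: integrable_fejer.
by rewrite RintegralZr// RintegralD// !integral_fejer /tent; field.
Qed.

Lemma measurable_cosM t : measurable_fun [set: measurableTypeR R] (fun x => cos (t * x)).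
Proof.
apply: (measurableT_comp (continuous_measurable_fun (@continuous_cos R))).
exact: measurable_funM.
Qed.

Lemma measurable_sinM t : measurable_fun [set: measurableTypeR R] (fun x => sin (t * x)).
Proof.
apply: (measurableT_comp (continuous_measurable_fun (@continuous_sin R))).
exact: measurable_funM.
Qed.

Lemma integrable_fejer_cos e t :
  lam.-integrable setT (EFin \o (fun x => fejer e x * cos (t * x))).
Proof. by apply: integrable_fejerM => [|x]; [exact: measurable_cosM|exact: cos_max]. Qed.

Lemma integrable_fejer_sin e t :
  lam.-integrable setT (EFin \o (fun x => fejer e x * sin (t * x))).
Proof. by apply: integrable_fejerM => [|x]; [exact: measurable_sinM|exact: sin_max]. Qed.

(** The integrand is odd, but the change of variables is stated for nonnegative functions. It is
    applied to the kernel times 1 + sin(tx), which the reflection of x carries to the kernel times 1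
    - sin(tx). *)
Lemma integral_fejer_sin e t : \int[lam]_x (fejer e x * sin (t * x)) = 0.
Proof.
pose h s x := fejer e x * (1 + s * sin (t * x)).
have hE s : \int[lam]_x h s x =
    \int[lam]_x fejer e x + s * \int[lam]_x (fejer e x * sin (t * x)).
  have i1 := integrable_fejer e; have i2 := integrable_fejer_sin e t.
  have i3 : lam.-integrable setT (EFin \o (fun x => s * (fejer e x * sin (t * x)))).
    exact: (integrableZl measurableT s i2).
  rewrite -RintegralZl// -RintegralD//; apply: eq_Rintegral => x _.
  by rewrite /h mulrDr mulr1 mulrCA.
have h_ge0 s x : `|s| <= 1 -> 0 <= h s x.
  move=> s1; rewrite mulr_ge0 ?fejer_ge0//.
  have : `|s * sin (t * x)| <= 1 by rewrite normrM mulr_ile1// sin_max.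
  by rewrite ler_norml => /andP[]; rewrite -lerBlDl sub0r.
have mh s : measurable_fun [set: measurableTypeR R] (h s).
  apply: measurable_funM; first exact: measurable_fejer.
  by apply: measurable_funD => //; apply: measurable_funM => //; exact: measurable_sinM.
have : \int[lam]_x h 1 x = \int[lam]_x h (-1) x.
  rewrite /Rintegral; congr fine.
  have N10 : -1 != 0 :> R by rewrite oppr_eq0 oner_eq0.
  have := lebesgue_affine (f := EFin \o h 1) 0 N10.
  move=> ->; [|exact/measurable_EFinP|by move=> x /=; rewrite lee_fin h_ge0 ?normr1].
  rewrite normrN1 mul1e; apply: eq_integral => x _ /=; congr EFin.
  rewrite /h addr0 mulN1r mulrN sinN mulrN mul1r mulN1r; congr (_ * _).
  by rewrite /fejer oppr_eq0 mulrN cosN sqrrN.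
rewrite !hE => /addrI; set I := (\int[lam]_x _); move: I => I; clear; lra.
Qed.

Lemma tent_ge0 e t : 0 <= tent e t.
Proof.
rewrite /tent subr_ge0 ler_pdivlMr// mulr_natr mulr2n.
have -> : `|t| + `|t| = `|(t + e) + (t - e)|.
  by rewrite addrACA subrr addr0 -mulr2n normrMn mulr2n.
exact: ler_normD.
Qed.

Lemma tent_le e t : tent e t <= `|e|.
Proof.
have := ler_normD t e; have := ler_normB t e; rewrite /tent; lra.
Qed.

Lemma tent_eq0 e t : `|e| <= `|t| -> tent e t = 0.
Proof.
rewrite /tent; case: (ger0P t) => t0; case: (ger0P e) => e0;
case: (ger0P (t + e)); case: (ger0P (t - e)) => *; lra.
Qed.

Lemma continuous_tent e : continuous (tent e).
Proof.
move=> x; rewrite /tent; apply: cvgB; last exact: (@cvg_norm _ R^o).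
apply: cvgM; last exact: cvg_cst.
by apply: cvgD; apply: (@cvg_norm _ R^o); apply: cvgD => //; exact: cvg_cst.
Qed.

Lemma measurable_tent e : measurable_fun [set: measurableTypeR R] (tent e).
Proof. by apply: continuous_measurable_fun; exact: continuous_tent. Qed.

Lemma tentZ e t : 0 < e -> tent e (e * t) = e * tent 1 t.
Proof.
move=> e0; rewrite /tent -{2 4}[e]mulr1 -mulrDr -mulrBr !normrM (gtr0_norm e0).
by rewrite -mulrDr -mulrA -mulrBr.
Qed.

Lemma integral_tent1_lty : (\int[lam]_x (tent 1 x)%:E < +oo)%E.
Proof.
apply: (@le_lt_trans _ _ (\int[lam]_x (\1_(`[-1, 1]%classic : set R) x)%:E)%E).
  apply: ge0_le_integral => //.
  - by move=> x _; rewrite lee_fin tent_ge0.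
  - by apply/measurable_EFinP; exact: measurable_tent.
  - by apply/measurable_EFinP; exact: measurable_indic.
  - move=> x _; rewrite lee_fin indicE; have [x1|x1] := leP `|x| 1.
      rewrite mem_set; first by rewrite (le_trans (tent_le _ _))// normr1.
      by rewrite /= in_itv/= -ler_norml.
    by rewrite tent_eq0 ?normr1 ?(ltW x1).
rewrite integral_indic//= setIT lebesgue_measure_itv/= lte_fin.
by rewrite ltrNl (lt_trans _ (@ltr01 R)) ?oppr_lt0// -EFinB ltry.
Qed.

Definition tent_mass : R := \int[lam]_x tent 1 x.

Lemma integral_tentE x e : 0 < e ->
  (\int[lam]_y (tent e (x - y)%R)%:E = (e ^+ 2 * tent_mass)%:E)%E.
Proof.
move=> e0; have Ne0 : - e != 0 by rewrite oppr_eq0 gt_eqF.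
have mt : measurable_fun [set: measurableTypeR R] (fun y => (tent e (x - y))%:E).
  apply/measurable_EFinP; apply: (measurableT_comp (measurable_tent e)).
  exact: measurable_funB.
rewrite (lebesgue_affine x Ne0 mt); last by move=> y; rewrite lee_fin tent_ge0.
under eq_integral do rewrite /= mulNr opprD opprK addrCA subrr addr0 tentZ// EFinM.
rewrite ge0_integralZl//; last 3 first.
- by apply/measurable_EFinP; exact: measurable_tent.
- by move=> y _; rewrite lee_fin tent_ge0.
- by rewrite lee_fin ltW.
rewrite muleA -EFinM normrN gtr0_norm// -expr2 [RHS]EFinM; congr (_ * _)%E.
rewrite /tent_mass /Rintegral fineK// ge0_fin_numE ?integral_tent1_lty//.
by apply: integral_ge0 => y _; rewrite lee_fin tent_ge0.
Qed.

Lemma tent_mass_gt0 : 0 < tent_mass.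
Proof.
rewrite -lte_fin /tent_mass /Rintegral fineK; last first.
  rewrite ge0_fin_numE ?integral_tent1_lty//.
  by apply: integral_ge0 => y _; rewrite lee_fin tent_ge0.
have half0 : 0 < 2^-1 :> R by rewrite invr_gt0.
apply: (@lt_le_trans _ _ (\int[lam]_(x in `[0%R, (2^-1)%R]) (2^-1)%R%:E)%E).
  rewrite integral_cst//= lebesgue_measure_itv/= lte_fin half0.
  by rewrite -EFinB -EFinM lte_fin mulr_gt0// subr0.
apply: (@le_trans _ _ (\int[lam]_(x in `[0%R, (2^-1)%R]) (tent 1 x)%:E)%E).
  apply: ge0_le_integral => //=.
  - by apply: measurable_funTS; apply/measurable_EFinP; exact: measurable_tent.
  - move=> x; rewrite in_itv/= => /andP[xge xle]; rewrite lee_fin /tent.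
    rewrite (ger0_norm xge) ger0_norm ?addr_ge0// ler0_norm; lra.
apply: ge0_subset_integral => //.
  by apply/measurable_EFinP; exact: measurable_tent.
by move=> x _; rewrite lee_fin tent_ge0.
Qed.

Lemma integrable_tent x e : 0 < e -> lam.-integrable setT (EFin \o (fun y => tent e (x - y))).
Proof.
move=> e0; apply/integrableP; split.
  apply/measurable_EFinP; apply: (measurableT_comp (measurable_tent e)).
  exact: measurable_funB.
by under eq_integral do rewrite /= ger0_norm ?tent_ge0//; rewrite integral_tentE// ltry.
Qed.

Lemma integral_tent x e : 0 < e -> \int[lam]_y tent e (x - y) = e ^+ 2 * tent_mass.
Proof. by move=> e0; rewrite /Rintegral integral_tentE. Qed.

End FejerKernel.

(** * Fourier inversion in several variables *)

Section ProductIntegral.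
Context {d1 d2 : measure_display} {T1 : measurableType d1} {T2 : measurableType d2}
  {R : realType}.
Variables (m1 : {sigma_finite_measure set T1 -> \bar R})
  (m2 : {sigma_finite_measure set T2 -> \bar R}).

Lemma integrable_prodM (f : T1 -> R) (g : T2 -> R) :
  m1.-integrable setT (EFin \o f) -> m2.-integrable setT (EFin \o g) ->
  (m1 \x m2)%E.-integrable setT (fun p => (f p.1 * g p.2)%:E).
Proof.
move=> /integrableP[mf intf] /integrableP[mg intg].
have mf' : measurable_fun setT f by exact/measurable_EFinP.
have mg' : measurable_fun setT g by exact/measurable_EFinP.
apply/integrable12ltyP.
  apply/measurable_EFinP; apply: measurable_funM.
    exact: measurableT_comp measurable_fst.
  exact: measurableT_comp measurable_snd.
have g_fin : (\int[m2]_y `|(g y)%:E|)%E \is a fin_num.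
  by rewrite ge0_fin_numE// integral_ge0.
rewrite (eq_integral (fun x => `|(f x)%:E| * \int[m2]_y `|(g y)%:E|)%E); last first.
  move=> x _; rewrite -ge0_integralZl//; last exact: measurableT_comp mg.
  by apply: eq_integral => y _; rewrite /= normrM EFinM.
rewrite ge0_integralZr//.
- by rewrite muleC lte_mul_pinfty// integral_ge0.
- exact: measurableT_comp mf.
- by rewrite integral_ge0.
Qed.

Variable F : T1 * T2 -> R.
Hypothesis intF : (m1 \x m2)%E.-integrable setT (EFin \o F).
Hypothesis intF1 : forall x, m2.-integrable setT (EFin \o (fun y => F (x, y))).

(** Integrability of every section, not just almost every one, makes the real inner integral agree
    with the extended one at all [x]. *)
Lemma integrable_section : m1.-integrable setT (EFin \o (fun x => \int[m2]_y F (x, y))).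
Proof.
have := integrable_fubini_F intF; apply: eq_integrable => // x _.
by rewrite /fubini_F /Rintegral /= fineK//; apply: integrable_fin_num => //; exact: (intF1 x).
Qed.

Lemma Rintegral_fubini1 :
  \int[m1]_x (\int[m2]_y F (x, y)) = \int[(m1 \x m2)%E]_z F z.
Proof.
rewrite /Rintegral; congr fine; rewrite -(integral12_prod_meas1 intF).
apply: eq_integral => x _.
by rewrite /fubini_F /Rintegral /= fineK//; apply: integrable_fin_num => //; exact: (intF1 x).
Qed.

Hypothesis intF2 : forall y, m1.-integrable setT (EFin \o (fun x => F (x, y))).

Lemma Rintegral_fubini2 :
  \int[m2]_y (\int[m1]_x F (x, y)) = \int[(m1 \x m2)%E]_z F z.
Proof.
rewrite -Rintegral_fubini1 /Rintegral; congr fine.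
transitivity (\int[m2]_y (\int[m1]_x (EFin \o F) (x, y)))%E.
  apply: eq_integral => y _.
  by rewrite /fubini_F /Rintegral /= fineK//; apply: integrable_fin_num => //;
    exact: (intF2 y).
rewrite -(Fubini intF); apply: eq_integral => x _.
by rewrite /fubini_F /Rintegral /= fineK//; apply: integrable_fin_num => //; exact: (intF1 x).
Qed.

End ProductIntegral.

(** * Splitting off the first coordinate in integrals over row vectors *)

Section LebesgueRV.
Variable R : realType.
Local Notation lam := (@lebesgue_measure R).
Local Notation mu := (@lebesgue_rV R).
Local Notation X n := 'rV[measurableTypeR R]_n.

Lemma integral_rVS n (f : X n.+1 -> \bar R) : measurable_fun setT f ->
  (forall x, (0 <= f x)%E) ->
  (\int[mu n.+1]_x f x = \int[lam \x mu n]_p f (cons_rV p))%E.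
Proof.
move=> mf f0.
pose nu := measure_function_pushforward__canonical__measure_function_Measure
     (lam \x mu n)%E (@measurable_cons_rV R n).
transitivity (\int[nu]_x f x)%E; first by apply: eq_measure_integral => A mA _.
by rewrite (ge0_integral_pushforward (@measurable_cons_rV R n)).
Qed.

Lemma integrable_rVS n (f : X n.+1 -> R) : measurable_fun setT f ->
  (lam \x mu n)%E.-integrable setT (EFin \o (f \o @cons_rV R n)) ->
  (mu n.+1).-integrable setT (EFin \o f).
Proof.
move=> mf /integrableP[_ fi]; apply/integrableP; split; first exact/measurable_EFinP.
rewrite integral_rVS//.
by apply: measurableT_comp => //; exact/measurable_EFinP.
Qed.

Lemma Rintegral_rVS n (f : X n.+1 -> R) : measurable_fun setT f ->
  (lam \x mu n)%E.-integrable setT (EFin \o (f \o @cons_rV R n)) ->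
  \int[mu n.+1]_x f x = \int[(lam \x mu n)%E]_p f (cons_rV p).
Proof.
move=> mf fi; rewrite /Rintegral; congr fine.
pose nu := measure_function_pushforward__canonical__measure_function_Measure
     (lam \x mu n)%E (@measurable_cons_rV R n).
transitivity (\int[nu]_x (f x)%:E)%E; first by apply: eq_measure_integral => A mA _.
rewrite (integral_pushforward (@measurable_cons_rV R n))//.
exact/measurable_EFinP.
Qed.

Section ProductFunction.
Variables (n : nat) (f : R -> R) (g : X n -> R).
Hypotheses (intf : lam.-integrable setT (EFin \o f))
  (intg : (mu n).-integrable setT (EFin \o g)).

Let fg (x : X n.+1) := f (uncons_rV x).1 * g (uncons_rV x).2.

Let mfg : measurable_fun setT fg.
Proof.
have mf : measurable_fun setT f by apply/measurable_EFinP; exact: measurable_int intf.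
have mg : measurable_fun setT g by apply/measurable_EFinP; exact: measurable_int intg.
have mu1 := @measurable_uncons_rV R n.
apply: measurable_funM.
  by apply: (measurableT_comp mf); exact: measurableT_comp measurable_fst mu1.
by apply: (measurableT_comp mg); exact: measurableT_comp measurable_snd mu1.
Qed.

Let fgE : EFin \o (fg \o @cons_rV R n) = fun p => (f p.1 * g p.2)%:E.
Proof. by apply/funext => p; rewrite /= /fg cons_rVK. Qed.

Lemma integrable_rVSM : (mu n.+1).-integrable setT
  (EFin \o (fun x => f (uncons_rV x).1 * g (uncons_rV x).2)).
Proof. by apply: integrable_rVS => //; rewrite fgE; exact: integrable_prodM. Qed.

Lemma Rintegral_rVSM : \int[mu n.+1]_x (f (uncons_rV x).1 * g (uncons_rV x).2) =
  \int[lam]_x f x * \int[mu n]_x g x.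
Proof.
have fgi := integrable_prodM intf intg.
rewrite Rintegral_rVS//; last by rewrite fgE.
transitivity (\int[(lam \x mu n)%E]_p (f p.1 * g p.2)).
  by apply: eq_Rintegral => p _; rewrite cons_rVK.
rewrite -(Rintegral_fubini1 fgi) => [|x]; last first.
  exact: (integrableZl measurableT (f x) intg).
by rewrite -RintegralZr//; apply: eq_Rintegral => x _ /=; rewrite RintegralZl.
Qed.

End ProductFunction.

Lemma dotp_uncons n (x y : X n.+1) : dotp (x : 'rV[R]_n.+1) y =
  (uncons_rV x).1 * (uncons_rV y).1 + dotp (uncons_rV x).2 (uncons_rV y).2.
Proof.
rewrite /dotp big_ord_recl; congr (_ + _).
by apply: eq_bigr => i _; rewrite !mxE; congr (x _ _ * y _ _); exact: val_inj.
Qed.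

End LebesgueRV.

(** * Integrals of products of one-variable functions *)

Section TensorIntegral.
Variable R : realType.
Local Notation lam := (@lebesgue_measure R).
Local Notation mu := (@lebesgue_rV R).
Local Notation X n := 'rV[measurableTypeR R]_n.

Lemma integrable_rV0 (f : X 0 -> R) : (mu 0).-integrable setT (EFin \o f).
Proof.
rewrite (_ : EFin \o f = cst (f (0 : 'rV[R]_0))%:E); last first.
  by apply/funext => x /=; congr (f _)%:E; exact: thinmx0.
apply/integrableP; split; first exact: measurable_cst.
by rewrite integral_cst//= diracT mule1 ltry.
Qed.

Lemma Rintegral_rV0 (f : X 0 -> R) : \int[mu 0]_x f x = f (0 : 'rV[R]_0).
Proof.
rewrite (_ : f = cst (f (0 : 'rV[R]_0))); last first.
  by apply/funext => x /=; congr f; exact: thinmx0.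
rewrite Rintegral_cst//; transitivity (f (0 : 'rV[R]_0) * 1); last by rewrite mulr1.
by congr (_ * _); exact: (congr1 fine (diracT R (0 : X 0))) .
Qed.

Definition tensor n (f : 'I_n -> R -> R) (x : 'rV[R]_n) : R := \prod_(i < n) f i (x ord0 i).

Lemma tensor_uncons n (f : 'I_n.+1 -> R -> R) (x : X n.+1) :
  tensor f x = f ord0 (uncons_rV x).1 *
    tensor (fun i => f (lift ord0 i)) (uncons_rV x).2.
Proof.
rewrite /tensor big_ord_recl; congr (_ * _).
by apply: eq_bigr => i _; rewrite mxE; congr (f _ (x _ _)); exact: val_inj.
Qed.

Lemma integrable_tensor n (f : 'I_n -> R -> R) :
  (forall i, lam.-integrable setT (EFin \o f i)) ->
  (mu n).-integrable setT (EFin \o tensor f) /\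
  \int[mu n]_x tensor f x = \prod_(i < n) \int[lam]_x f i x.
Proof.
elim: n f => [|n IH] f intf.
  by split; [exact: integrable_rV0|rewrite Rintegral_rV0 /tensor !big_ord0].
have [int_tl tlE] := IH (fun i => f (lift ord0 i)) (fun i => intf _).
have tE := funext (tensor_uncons f).
rewrite big_ord_recl -tlE -Rintegral_rVSM// tE; split=> //.
exact: (integrable_rVSM (intf ord0) int_tl).
Qed.

Definition fejer_rV n e (x : 'rV[R]_n) : R := tensor (fun=> fejer e) x.

Lemma fejer_rV_ge0 n e (x : 'rV[R]_n) : 0 <= fejer_rV e x.
Proof. by apply: prodr_ge0 => i _; exact: fejer_ge0. Qed.

(** The addition formulas reduce dimension [n.+1] to products of one-dimensional and [n]-dimensional
    integrals. They mix cosine and sine, so all four claims go through one induction; every product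
    with a sine factor integrates to 0. *)
Lemma integral_fejer_rV n e (x : 'rV[R]_n) :
  [/\ (mu n).-integrable setT (EFin \o (fun xi => fejer_rV e xi * cos (dotp x xi))),
      (mu n).-integrable setT (EFin \o (fun xi => fejer_rV e xi * sin (dotp x xi))),
      \int[mu n]_xi (fejer_rV e xi * cos (dotp x xi)) =
        \prod_(i < n) (fejer_mass R * tent e (x ord0 i)) &
      \int[mu n]_xi (fejer_rV e xi * sin (dotp x xi)) = 0].
Proof.
elim: n x => [|n IH] x.
  split; try exact: integrable_rV0.
    by rewrite Rintegral_rV0 /fejer_rV /tensor /dotp !big_ord0 cos0 mulr1.
  by rewrite Rintegral_rV0 /dotp !big_ord0 sin0 mulr0.
pose x0 : R := (uncons_rV x).1; pose x' : 'rV[R]_n := (uncons_rV x).2.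
have [ic is_ cE sE] := IH x'.
have ic0 := @integrable_fejer_cos R e x0; have is0 := @integrable_fejer_sin R e x0.
have cosE : (fun xi : X n.+1 => fejer_rV e xi * cos (dotp x xi)) = (fun xi : X n.+1 =>
    (fun t => fejer e t * cos (x0 * t)) (uncons_rV xi).1 *
      (fun v => fejer_rV e v * cos (dotp x' v)) (uncons_rV xi).2 -
    (fun t => fejer e t * sin (x0 * t)) (uncons_rV xi).1 *
      (fun v => fejer_rV e v * sin (dotp x' v)) (uncons_rV xi).2).
  by apply/funext => xi; rewrite dotp_uncons cosD /fejer_rV tensor_uncons; ring.
have sinE : (fun xi : X n.+1 => fejer_rV e xi * sin (dotp x xi)) = (fun xi : X n.+1 =>
    (fun t => fejer e t * sin (x0 * t)) (uncons_rV xi).1 *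
      (fun v => fejer_rV e v * cos (dotp x' v)) (uncons_rV xi).2 +
    (fun t => fejer e t * cos (x0 * t)) (uncons_rV xi).1 *
      (fun v => fejer_rV e v * sin (dotp x' v)) (uncons_rV xi).2).
  by apply/funext => xi; rewrite dotp_uncons sinD /fejer_rV tensor_uncons; ring.
have icc := integrable_rVSM ic0 ic; have iss := integrable_rVSM is0 is_.
have isc := integrable_rVSM is0 ic; have ics := integrable_rVSM ic0 is_.
split.
- by rewrite cosE; exact: (integrableB measurableT icc iss).
- by rewrite sinE; exact: (integrableD measurableT isc ics).
- rewrite cosE RintegralB// (Rintegral_rVSM ic0 ic) (Rintegral_rVSM is0 is_).
  rewrite integral_fejer_cos integral_fejer_sin mul0r subr0 cE big_ord_recl.
  congr (_ * _); apply: eq_bigr => i _; rewrite mxE; congr (_ * tent _ (x _ _)).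
  exact: val_inj.
- rewrite sinE RintegralD// (Rintegral_rVSM is0 ic) (Rintegral_rVSM ic0 is_).
  by rewrite integral_fejer_sin mul0r add0r sE mulr0.
Qed.

End TensorIntegral.

Lemma integrable_mul_bounded d (T : measurableType d) (R : realType)
    (m : {measure set T -> \bar R}) (f h : T -> R) (M : R) :
  m.-integrable setT (EFin \o f) -> measurable_fun setT h ->
  (forall x, `|h x| <= M) ->
  m.-integrable setT (EFin \o (fun x => f x * h x)).
Proof.
move=> intf mh hM.
have intM : m.-integrable setT (EFin \o (fun x => M * f x)).
  exact: (integrableZl measurableT M intf).
apply: le_integrable intM => //.
  apply/measurable_EFinP/measurable_funM => //.
  by apply/measurable_EFinP; exact: measurable_int intf.
move=> x _; rewrite /= lee_fin !normrM mulrC ler_wpM2r//.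
by rewrite (le_trans (hM x))// ler_norm.
Qed.

(** * Cosine and sine transforms and the smoothed inversion identity *)

Section Inversion.
Variables (R : realType) (n : nat).
Local Notation mu := (@lebesgue_rV R).
Local Notation X := 'rV[measurableTypeR R]_n.

Lemma measurable_dotp2 : measurable_fun setT (fun p : X * X => dotp (p.1 : 'rV[R]_n) p.2).
Proof.
apply: measurable_sum => i; apply: measurable_funM.
  apply: (measurableT_comp (@measurable_coord _ (measurableTypeR R) n i)).
  exact: measurable_fst.
apply: (measurableT_comp (@measurable_coord _ (measurableTypeR R) n i)).
exact: measurable_snd.
Qed.

Lemma measurable_dotpr (x : 'rV[R]_n) : measurable_fun setT (fun y : X => dotp x y).
Proof.
apply: measurable_sum => i; apply: measurable_funM => //.
exact: (@measurable_coord _ (measurableTypeR R) n i).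
Qed.

Lemma measurable_dotpl (x : 'rV[R]_n) :
  measurable_fun setT (fun y : X => dotp (y : 'rV[R]_n) x).
Proof.
apply: measurable_sum => i; apply: measurable_funM => //.
exact: (@measurable_coord _ (measurableTypeR R) n i).
Qed.

Lemma measurable_cos_comp d (T : measurableType d) (f : T -> R) :
  measurable_fun setT f -> measurable_fun setT (fun x => cos (f x)).
Proof.
exact: (measurableT_comp (continuous_measurable_fun (@continuous_cos R))).
Qed.

Lemma measurable_sin_comp d (T : measurableType d) (f : T -> R) :
  measurable_fun setT f -> measurable_fun setT (fun x => sin (f x)).
Proof.
exact: (measurableT_comp (continuous_measurable_fun (@continuous_sin R))).
Qed.

Lemma dotpBl (x y z : 'rV[R]_n) : dotp (x - y) z = dotp x z - dotp y z.
Proof.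
by rewrite /dotp -sumrB; apply: eq_bigr => i _; rewrite !mxE mulrBl.
Qed.

Variable u : 'rV[R]_n -> R.
Hypothesis intu : (mu n).-integrable setT (EFin \o u).

Definition cos_transform (xi : 'rV[R]_n) : R := \int[mu n]_y (u y * cos (dotp y xi)).
Definition sin_transform (xi : 'rV[R]_n) : R := \int[mu n]_y (u y * sin (dotp y xi)).

Lemma integrable_cos_transform xi :
  (mu n).-integrable setT (EFin \o (fun y => u y * cos (dotp y xi))).
Proof.
apply: (integrable_mul_bounded (M := 1)) => // [|y]; last exact: cos_max.
by apply: measurable_cos_comp; exact: measurable_dotpl.
Qed.

Lemma integrable_sin_transform xi :
  (mu n).-integrable setT (EFin \o (fun y => u y * sin (dotp y xi))).
Proof.
apply: (integrable_mul_bounded (M := 1)) => // [|y]; last exact: sin_max.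
by apply: measurable_sin_comp; exact: measurable_dotpl.
Qed.

(** The real part of the Fourier transform of [u] at [xi] times exp(i<x,xi>). *)
Definition inverse_integrand (x xi : 'rV[R]_n) : R :=
  cos_transform xi * cos (dotp x xi) + sin_transform xi * sin (dotp x xi).

Lemma integral_cos_sub x xi : \int[mu n]_y (u y * cos (dotp (x - y) xi)) =
  inverse_integrand x xi.
Proof.
have ic := integrable_cos_transform xi; have is_ := integrable_sin_transform xi.
rewrite /inverse_integrand /cos_transform /sin_transform.
rewrite -!RintegralZr// -RintegralD//; last 2 first.
- exact: (integrableZr measurableT (cos (dotp x xi)) ic).
- exact: (integrableZr measurableT (sin (dotp x xi)) is_).
by apply: eq_Rintegral => y _; rewrite dotpBl cosB; ring.
Qed.

Lemma integrable_cos_sub x (S : 'rV[R]_n -> R) :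
  (mu n).-integrable setT (EFin \o S) ->
  (mu n \x mu n)%E.-integrable setT
    (EFin \o (fun p : X * X => u p.1 * S p.2 * cos (dotp (x - p.1) p.2))).
Proof.
move=> intS; apply: (integrable_mul_bounded (M := 1)).
- exact: integrable_prodM.
- apply: measurable_cos_comp.
  rewrite (_ : (fun p => _) = fun p : X * X => dotp x p.2 - dotp (p.1 : 'rV[R]_n) p.2).
    apply: measurable_funB; last exact: measurable_dotp2.
    by apply: (measurableT_comp (measurable_dotpr x)); exact: measurable_snd.
  by apply/funext => p; rewrite dotpBl.
- by move=> p; exact: cos_max.
Qed.

Definition tent_rV e (x y : 'rV[R]_n) : R := \prod_(i < n) tent e (x ord0 i - y ord0 i).

Lemma integral_tent_rV e x : 0 < e ->
  (mu n).-integrable setT (EFin \o tent_rV e x) /\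
  \int[mu n]_y tent_rV e x y = (e ^+ 2 * tent_mass R) ^+ n.
Proof.
move=> e0.
have [] := integrable_tensor (f := fun (i : 'I_n) y => tent e (x ord0 i - y)).
  by move=> i; exact: integrable_tent.
move=> intt tE; split=> //; apply: (etrans tE).
under eq_bigr do rewrite integral_tent//.
by rewrite prodr_const card_ord.
Qed.

(** Fubini for u(y) F(xi) cos<x-y,xi>, with F the integrable Fejer kernel: integrating over [xi]
    first produces the tents, integrating over y first produces the inversion integrand. *)
Lemma fejer_parseval e x : 0 < e ->
  \int[mu n]_y (u y * (fejer_mass R ^+ n * tent_rV e x y)) =
  \int[mu n]_xi (fejer_rV e xi * inverse_integrand x xi).
Proof.
move=> e0.
have [intS _] := integrable_tensor (f := fun=> fejer e) (fun i : 'I_n => integrable_fejer e).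
have intF := integrable_cos_sub x intS.
have cosE y := integral_fejer_rV e (x - y).
transitivity (\int[mu n]_y \int[mu n]_xi (u y * fejer_rV e xi * cos (dotp (x - y) xi))).
  apply: eq_Rintegral => y _; under [RHS]eq_Rintegral do rewrite -mulrA.
  have [ic _ cE _] := cosE y; rewrite RintegralZl// cE big_split/= prodr_const card_ord.
  by congr (_ * (_ * _)); apply: eq_bigr => i _; rewrite !mxE.
rewrite (Rintegral_fubini1 intF) => [|y]; last first.
  have [ic _ _ _] := cosE y.
  have := integrableZl measurableT (u y) ic.
  by apply: eq_integrable => // xi _ /=; rewrite -mulrA EFinM.
have intu_cos xi : (mu n).-integrable setT (EFin \o (fun y => u y * cos (dotp (x - y) xi))).
  apply: (integrable_mul_bounded (M := 1)) => // [|y]; last exact: cos_max.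
  apply: measurable_cos_comp.
  rewrite (_ : (fun p => _) = fun y : X => dotp x xi - dotp (y : 'rV[R]_n) xi).
    by apply: measurable_funB => //; exact: measurable_dotpl.
  by apply/funext => p; rewrite dotpBl.
rewrite -(Rintegral_fubini2 intF) => [|y|xi].
- apply: eq_Rintegral => xi _; rewrite -integral_cos_sub -RintegralZl//.
  by apply: eq_Rintegral => y _; rewrite /fejer_rV; ring.
- have [ic _ _ _] := cosE y.
  have := integrableZl measurableT (u y) ic.
  by apply: eq_integrable => // xi _ /=; rewrite -mulrA EFinM.
- have := integrableZl measurableT (fejer_rV e xi) (intu_cos xi).
  by apply: eq_integrable => // y _ /=; rewrite -EFinM /fejer_rV; congr EFin; ring.
Qed.

End Inversion.

Lemma Rdominated_convergence d (T : measurableType d) (R : realType)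
    (m : {measure set T -> \bar R}) (f_ : (T -> R)^nat) (f g : T -> R) :
  (forall k, measurable_fun setT (f_ k)) -> measurable_fun setT f ->
  (forall x, f_ ^~ x @ \oo --> f x) ->
  m.-integrable setT (EFin \o g) -> (forall k x, `|f_ k x| <= g x) ->
  (fun k => \int[m]_x f_ k x) @ \oo --> \int[m]_x f x.
Proof.
move=> mf_ mf f_f intg f_g.
have [| | | | intf _ cvg_int] := @dominated_convergence _ T R m setT measurableT
  (fun k => EFin \o f_ k) (EFin \o f) (EFin \o g) _ _ _ intg.
- by move=> k; apply/measurable_EFinP.
- exact/measurable_EFinP.
- by apply: aeW => x _; apply: cvg_EFin; [exact: nearW|exact: f_f].
- by apply: aeW => x k _; rewrite /= lee_fin.
apply: fine_cvg; rewrite /Rintegral fineK//.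
exact: integrable_fin_num.
Qed.

(** * The frequency side as the Fejer parameter tends to 0 *)

Section FejerLimit.
Variable R : realType.

Lemma sin_div_cvg : (fun h : R => sin h / h) @ 0^' --> (1 : R).
Proof.
have d0 := @is_derive_sin R 0.
have := @ex_derive _ _ _ _ _ _ _ d0 => dsin.
have /cvg_lim lim_sin := dsin; have := @derive_val _ _ _ _ _ _ _ d0.
rewrite cos0 /derive => lim1; rewrite -lim1.
apply: cvg_trans dsin; apply: near_eq_cvg; near=> h.
by rewrite /= sin0 subr0 addr0 /GRing.scale/= mulr1 mulrC.
Unshelve. all: by end_near.
Qed.

(** For [x != 0] the half-angle formula turns the quotient into half the square of sin(s)/s with s =
    ex/2; at [x = 0] it is constant. *)
Lemma fejer_div_cvg (e : R^nat) x : e @ \oo --> 0 -> (forall k, e k != 0) ->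
  (fun k => fejer (e k) x / e k ^+ 2) @ \oo --> (2^-1 : R).
Proof.
move=> e0 en0; have [->|x0] := eqVneq x 0.
  rewrite (_ : (fun k => _) = cst (2^-1 : R)); first exact: cvg_cst.
  by apply/funext => k; rewrite /fejer eqxx /=; field; exact: en0.
pose s k := e k * x / 2.
have s0 : s @ \oo --> 0.
  rewrite -[X in _ --> X](mul0r (x / 2)).
  rewrite (_ : s = fun k => e k * (x / 2)); first by apply: cvgM => //; exact: cvg_cst.
  by apply/funext => k; rewrite /s mulrA.
have sn0 k : s k != 0 by rewrite /s !mulf_neq0// invr_neq0.
have cvg1 : (fun k => sin (s k) / s k) @ \oo --> (1 : R).
  by move/cvgr_dnbhsP : sin_div_cvg; apply; split.
have -> : (fun k => fejer (e k) x / e k ^+ 2) =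
    fun k => 2^-1 * ((sin (s k) / s k) * (sin (s k) / s k)).
  apply/funext => k; rewrite /fejer (negbTE x0) oneB_cosE -/(s k) /s.
  by field; rewrite x0 en0.
have : (fun k => 2^-1 * ((sin (s k) / s k) * (sin (s k) / s k))) @ \oo -->
    (2^-1 * (1 * 1) : R).
  by apply: cvgM; [exact: cvg_cst|exact: cvgM].
by rewrite !mulr1.
Qed.

End FejerLimit.

Section FejerSide.
Variables (R : realType) (n : nat) (u : 'rV[R]_n -> R).
Local Notation mu := (@lebesgue_rV R).
Local Notation lam := (@lebesgue_measure R).
Local Notation X := 'rV[measurableTypeR R]_n.
Hypothesis intu : (mu n).-integrable setT (EFin \o u).
Variable B : R.
Hypothesis cos_transform_supp : forall (xi : 'rV[R]_n) i, B < `|xi ord0 i| ->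
  cos_transform u xi = 0.
Hypothesis sin_transform_supp : forall (xi : 'rV[R]_n) i, B < `|xi ord0 i| ->
  sin_transform u xi = 0.

(** The indicator of a cube, written as a tensor so that [integrable_tensor] applies. *)
Let box (xi : 'rV[R]_n) : R := tensor (fun=> \1_(`[- B, B]%classic)) xi.

Let boxE xi (f : 'rV[R]_n -> R) : (forall (xi : 'rV[R]_n) i, B < `|xi ord0 i| -> f xi = 0) ->
  box xi * f xi = f xi.
Proof.
move=> f0; rewrite /box /tensor.
have [/existsP[i Bi]|] := boolP [exists i : 'I_n, B < `|xi ord0 i|].
  by rewrite (f0 _ i Bi) mulr0.
move=> /existsPn le_B; rewrite big1 ?mul1r// => i _.
by rewrite indicE mem_set//= in_itv/= -ler_norml leNgt le_B.
Qed.

Let integrable_box : (mu n).-integrable setT (EFin \o box).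
Proof.
have intI (_ : 'I_n) : lam.-integrable setT (EFin \o \1_(`[- B, B]%classic)).
  exact: integrable_indic_itv.
by have [] := integrable_tensor intI.
Qed.

(** Multiplying by the indicator of the box leaves the transforms unchanged but makes the kernel
    integrable on the product space; Fubini then yields measurability and integrability together. In
    [key], [g] is cosine or sine. *)
Lemma integrable_transforms :
  (mu n).-integrable setT (EFin \o cos_transform u) /\
  (mu n).-integrable setT (EFin \o sin_transform u).
Proof.
have key (g : R -> R) : (forall t, `|g t| <= 1) ->
    (forall d (T : measurableType d) (h : T -> R), measurable_fun setT h ->
      measurable_fun setT (fun x => g (h x))) ->
    (forall (xi : 'rV[R]_n) i, B < `|xi ord0 i| -> \int[mu n]_y (u y * g (dotp y xi)) = 0) ->
    (mu n).-integrable setT (EFin \o (fun xi => \int[mu n]_y (u y * g (dotp y xi)))).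
  move=> g1 mg g0.
  have intg xi : (mu n).-integrable setT (EFin \o (fun y => u y * g (dotp y xi))).
    by apply: (integrable_mul_bounded (M := 1)) => //; apply: mg; exact: measurable_dotpl.
  have intF : (mu n \x mu n)%E.-integrable setT
      (EFin \o (fun p : X * X => box p.1 * u p.2 * g (dotp (p.2 : 'rV[R]_n) p.1))).
    apply: (integrable_mul_bounded (M := 1)) => //; first exact: integrable_prodM.
    apply: mg; rewrite (_ : (fun p => _) = fun p : X * X => dotp (p.1 : 'rV[R]_n) p.2).
      exact: measurable_dotp2.
    by apply/funext => p; rewrite /dotp; apply: eq_bigr => i _; exact: mulrC.
  have intF1 xi : (mu n).-integrable setT (EFin \o (fun y => box xi * u y * g (dotp y xi))).
    have := integrableZl measurableT (box xi) (intg xi).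
    by apply: eq_integrable => // y _ /=; rewrite -mulrA EFinM.
  have := integrable_section intF intF1; apply: eq_integrable => // xi _ /=; congr EFin.
  rewrite -[RHS](boxE _ g0) -RintegralZl//; apply: eq_Rintegral => y _.
  by rewrite mulrA.
split; apply: key => //.
- exact: cos_max.
- by move=> d T h; exact: measurable_cos_comp.
- exact: sin_max.
- by move=> d T h; exact: measurable_sin_comp.
Qed.

Lemma integrable_inverse_integrand x :
  (mu n).-integrable setT (EFin \o inverse_integrand u x).
Proof.
have [ic is_] := integrable_transforms.
have ic1 : (mu n).-integrable setT (EFin \o (fun xi => cos_transform u xi * cos (dotp x xi))).
  apply: (integrable_mul_bounded (M := 1)) => // [|y]; last exact: cos_max.
  by apply: measurable_cos_comp; exact: measurable_dotpr.
have is1 : (mu n).-integrable setT (EFin \o (fun xi => sin_transform u xi * sin (dotp x xi))).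
  apply: (integrable_mul_bounded (M := 1)) => // [|y]; last exact: sin_max.
  by apply: measurable_sin_comp; exact: measurable_dotpr.
exact: (integrableD measurableT ic1 is1).
Qed.

Variable e : R^nat.
Hypothesis e_gt0 : forall k, 0 < e k.
Hypothesis e_cvg : e @ \oo --> 0.

(** Dominated convergence: the rescaled product kernel tends pointwise to [2^-1 ^+ n] and never
    exceeds it. *)
Lemma fejer_side_cvg x :
  (fun k => \int[mu n]_xi (fejer_rV (e k) xi * inverse_integrand u x xi) / (e k ^+ 2) ^+ n)
    @ \oo --> 2^-1 ^+ n * \int[mu n]_xi inverse_integrand u x xi.
Proof.
set w := inverse_integrand u x; have intw := integrable_inverse_integrand x.
have mw : measurable_fun setT w by apply/measurable_EFinP; exact: measurable_int intw.
have kE k : (fun xi => fejer_rV (e k) xi * w xi / (e k ^+ 2) ^+ n) =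
    (fun xi => (\prod_(i < n) (fejer (e k) (xi ord0 i) / e k ^+ 2)) * w xi).
  apply/funext => xi; rewrite mulrAC; congr (_ * _).
  by rewrite big_split/= prodr_const card_ord exprVn.
have mfk k : measurable_fun [set: X]
    (fun xi : X => \prod_(i < n) (fejer (e k) (xi ord0 i) / e k ^+ 2)).
  apply: measurable_prod => i _; apply: measurable_funM => //.
  apply: (measurableT_comp (measurable_fejer (e k))).
  exact: (@measurable_coord _ (measurableTypeR R) n i).
have fk_ge0 k (xi : X) : 0 <= \prod_(i < n) (fejer (e k) (xi ord0 i) / e k ^+ 2).
  by apply: prodr_ge0 => i _; rewrite divr_ge0 ?fejer_ge0 ?sqr_ge0.
have fk_le k (xi : X) : \prod_(i < n) (fejer (e k) (xi ord0 i) / e k ^+ 2) <= 2^-1 ^+ n.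
  rewrite (_ : 2^-1 ^+ n = \prod_(i < n) 2^-1); last by rewrite prodr_const card_ord.
  apply: ler_prod => i _; rewrite divr_ge0 ?fejer_ge0 ?sqr_ge0//=.
  by rewrite ler_pdivrMr ?exprn_gt0// mulrC fejer_le.
rewrite -RintegralZl//.
rewrite (_ : (fun k => _) = fun k => \int[mu n]_xi
   ((\prod_(i < n) (fejer (e k) (xi ord0 i) / e k ^+ 2)) * w xi)); last first.
  apply/funext => k; rewrite -kE RintegralZr//.
  have [intS _] := integrable_tensor (f := fun=> fejer (e k))
    (fun i : 'I_n => integrable_fejer (e k)).
  have mS : measurable_fun setT (fejer_rV (n := n) (e k)).
    by apply/measurable_EFinP; exact: measurable_int intS.
  have := integrable_mul_bounded (M := (e k ^+ 2 / 2) ^+ n) intw mS.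
  rewrite (_ : (fun xi => w xi * _) = fun xi => fejer_rV (e k) xi * w xi).
    apply => xi; rewrite ger0_norm ?fejer_rV_ge0//.
    rewrite (_ : _ ^+ n = \prod_(i < n) (e k ^+ 2 / 2)); last by rewrite prodr_const card_ord.
    by apply: ler_prod => i _; rewrite fejer_ge0 fejer_le.
  by apply/funext => xi; rewrite mulrC.
apply: (@Rdominated_convergence _ X R (mu n)
  (fun k xi => (\prod_(i < n) (fejer (e k) (xi ord0 i) / e k ^+ 2)) * w xi)
  (fun xi => 2^-1 ^+ n * w xi) (fun xi => 2^-1 ^+ n * `|w xi|)).
- by move=> k; exact: measurable_funM.
- exact: measurable_funM.
- move=> xi; apply: cvgM; last exact: cvg_cst.
  rewrite (_ : 2^-1 ^+ n = \prod_(i < n) 2^-1); last by rewrite prodr_const card_ord.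
  apply: cvg_big => [|i _].
    exact: mul_continuous.
  by apply: fejer_div_cvg => // k; rewrite gt_eqF.
- exact: (integrableZl measurableT (2^-1 ^+ n) (integrable_abse intw)).
- by move=> k xi; rewrite normrM ger0_norm// ler_wpM2r.
Qed.

End FejerSide.

(** * The space side as the tents shrink, and the inversion formula *)

Section InversionFormula.
Variables (R : realType) (n : nat) (u : 'rV[R]_n -> R).
Local Notation mu := (@lebesgue_rV R).
Local Notation X := 'rV[measurableTypeR R]_n.
Hypothesis intu : (mu n).-integrable setT (EFin \o u).
Hypothesis u_cont : continuous u.

Lemma tent_rV_ge0 e (x y : 'rV[R]_n) : 0 <= tent_rV e x y.
Proof. by apply: prodr_ge0 => i _; exact: tent_ge0. Qed.

(** The rescaled tents are an approximate identity: nonnegative, of constant mass [c], and zero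
    outside the cube of half-side [e k] around [x]. Continuity of [u] at [x] does the rest. *)
Lemma tent_side_cvg (e : R^nat) x : (forall k, 0 < e k) -> e @ \oo --> 0 ->
  (fun k => \int[mu n]_y (u y * (fejer_mass R ^+ n * tent_rV (e k) x y)) / (e k ^+ 2) ^+ n)
    @ \oo --> fejer_mass R ^+ n * tent_mass R ^+ n * u x.
Proof.
move=> e0 e_cvg; set c := fejer_mass R ^+ n * tent_mass R ^+ n.
have c0 : 0 < c by rewrite mulr_gt0// exprn_gt0 ?fejer_mass_gt0 ?tent_mass_gt0.
apply/cvgrPdist_le => eta eta0.
have etac : 0 < eta / c by rewrite divr_gt0.
have ux : u y @[y --> x] --> u x := @u_cont x.
move/cvgrPdist_le: ux => /(_ _ etac).
move=> /nbhs_ballP[d /= d0 ud].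
have /cvgrPdist_lt/(_ _ d0) := e_cvg; apply: filterS => k.
rewrite sub0r normrN gtr0_norm// => ekd.
pose K y := fejer_mass R ^+ n * tent_rV (e k) x y.
have K0 y : 0 <= K y by rewrite mulr_ge0 ?exprn_ge0 ?tent_rV_ge0// ltW// fejer_mass_gt0.
have [intt tE] := integral_tent_rV x (e0 k).
have intK : (mu n).-integrable setT (EFin \o K).
  exact: (integrableZl measurableT (fejer_mass R ^+ n) intt).
have KE : \int[mu n]_y K y = c * (e k ^+ 2) ^+ n.
  by rewrite RintegralZl// tE exprMn /c mulrCA mulrC -!mulrA.
have mK : measurable_fun setT K by apply/measurable_EFinP; exact: measurable_int intK.
have intuK : (mu n).-integrable setT (EFin \o (fun y => u y * K y)).
  apply: (integrable_mul_bounded (M := fejer_mass R ^+ n * e k ^+ n)) => // y.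
  rewrite ger0_norm// ler_wpM2l ?exprn_ge0 ?(ltW (fejer_mass_gt0 R))//.
  rewrite (_ : e k ^+ n = \prod_(i < n) e k); last by rewrite prodr_const card_ord.
  apply: ler_prod => i _; rewrite tent_ge0/= (le_trans (tent_le _ _))// gtr0_norm//.
have ek0 : 0 < (e k ^+ 2) ^+ n by rewrite !exprn_gt0.
have intuxK : (mu n).-integrable setT (EFin \o (fun y => u x * K y)).
  exact: (integrableZl measurableT (u x) intK).
rewrite -(ler_pM2r ek0) -[X in _ * X <= _](gtr0_norm ek0) -normrM mulrBl divfK ?gt_eqF//.
rewrite mulrAC -KE [_ * u x]mulrC -RintegralZl// -RintegralB//.
have intd := integrableB measurableT intuxK intuK.
apply: le_trans (le_normr_Rintegral measurableT intd) _.
apply: (@le_trans _ _ (\int[mu n]_y (eta / c * K y))).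
  apply: le_Rintegral => //.
  - exact: integrable_abse intd.
  - exact: (integrableZl measurableT (eta / c) intK).
  - move=> y _; rewrite -mulrBl normrM (ger0_norm (K0 y)).
    have [/existsP[i yi]|/existsPn yi] :=
      boolP [exists i : 'I_n, e k <= `|x ord0 i - y ord0 i|].
      have ti0 : tent (e k) (x ord0 i - y ord0 i) = 0 by rewrite tent_eq0 ?(gtr0_norm (e0 k)).
      by rewrite /K /tent_rV (bigD1 i)//= ti0 mul0r !mulr0.
    rewrite ler_wpM2r//; apply: ud; split=> // i j; rewrite ord1.
    apply: lt_trans ekd; rewrite ltNge; exact: yi.
by rewrite RintegralZl// KE mulrA divfK// gt_eqF.
Qed.

(** Both sides of [fejer_parseval], divided by [(e k ^+ 2) ^+ n] with e_k = 1/(k+1), converge, and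
    their limits must agree. The masses are positive, so the constant on the left can be divided
    out. *)
Lemma inversion_formula (B : R) :
  (forall (xi : 'rV[R]_n) i, B < `|xi ord0 i| -> cos_transform u xi = 0) ->
  (forall (xi : 'rV[R]_n) i, B < `|xi ord0 i| -> sin_transform u xi = 0) ->
  exists c : R, forall x, u x = c * \int[mu n]_xi inverse_integrand u x xi.
Proof.
move=> cu su; set c := fejer_mass R ^+ n * tent_mass R ^+ n.
have c0 : c != 0 by rewrite gt_eqF// mulr_gt0// exprn_gt0 ?fejer_mass_gt0 ?tent_mass_gt0.
exists (c^-1 * 2^-1 ^+ n) => x.
pose e (k : nat) : R := k.+1%:R^-1.
have e0 k : 0 < e k by rewrite /e invr_gt0.
have e_cvg : e @ \oo --> 0 by exact: cvg_harmonic.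
have lhs := tent_side_cvg (x := x) e0 e_cvg.
have rhs := fejer_side_cvg intu cu su e0 e_cvg (x := x).
rewrite -/c in lhs; rewrite -mulrA; apply: (mulfI c0); rewrite mulVKf//.
apply: cvg_unique lhs _ => //.
rewrite (_ : (fun k => _) = fun k =>
  \int[mu n]_xi (fejer_rV (e k) xi * inverse_integrand u x xi) / (e k ^+ 2) ^+ n)//.
by apply/funext => k; rewrite fejer_parseval.
Qed.

End InversionFormula.

(** * Band-limited functions are entire *)

Lemma Rintegral_sum d (T : measurableType d) (R : realType)
    (m : {measure set T -> \bar R}) (I : Type) (s : seq I) (F : I -> T -> R) :
  (forall i, m.-integrable setT (EFin \o F i)) ->
  m.-integrable setT (EFin \o (fun x => \sum_(i <- s) F i x)) /\
  \int[m]_x (\sum_(i <- s) F i x) = \sum_(i <- s) \int[m]_x F i x.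
Proof.
move=> intF; elim: s => [|i s [intS SE]].
  under [X in EFin \o X]eq_fun do rewrite big_nil.
  under [X in Rintegral _ _ X = _]eq_fun do rewrite big_nil.
  split; first by have := integrable0 m (@setT T); apply: eq_integrable.
  by rewrite big_nil /Rintegral integral0.
under [X in EFin \o X]eq_fun do rewrite big_cons.
under [X in Rintegral _ _ X = _]eq_fun do rewrite big_cons.
rewrite big_cons RintegralD// SE; split=> //.
exact: (integrableD measurableT (intF i) intS).
Qed.

(** * Term by term integration of a power series in <x,xi> *)

Section EntireIntegral.
Variables (R : realType) (n : nat) (G : 'rV[R]_n -> R) (B : R).
Local Notation mu := (@lebesgue_rV R).
Local Notation X := 'rV[measurableTypeR R]_n.
Hypothesis intG : (mu n).-integrable setT (EFin \o G).
Hypothesis B_ge0 : 0 <= B.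
Hypothesis G_supp : forall (xi : 'rV[R]_n) i, B < `|xi ord0 i| -> G xi = 0.

Let boxP (xi : 'rV[R]_n) : (G xi = 0) \/ (forall i, `|xi ord0 i| <= B).
Proof.
have [/existsP[i Bi]|/existsPn le_B] := boolP [exists i : 'I_n, B < `|xi ord0 i|].
  by left; exact: G_supp Bi.
by right=> i; rewrite leNgt le_B.
Qed.

Let mG : measurable_fun [set: X] G.
Proof. by apply/measurable_EFinP; exact: measurable_int intG. Qed.

Let integrable_on_box (h : 'rV[R]_n -> R) (M : R) : measurable_fun [set: X] h ->
  (forall xi : 'rV[R]_n, (forall i, `|xi ord0 i| <= B) -> `|h xi| <= M) ->
  (mu n).-integrable setT (EFin \o (fun xi => G xi * h xi)).
Proof.
move=> mh hM.
have intMG : (mu n).-integrable setT (EFin \o (fun xi => M * G xi)).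
  exact: (integrableZl measurableT M intG).
apply: le_integrable intMG => //.
  by apply/measurable_EFinP; exact: measurable_funM.
move=> xi _; rewrite /= lee_fin !normrM mulrC.
have [->|xiB] := boxP xi; first by rewrite normr0 !mulr0.
by rewrite ler_wpM2r// (le_trans (hM _ xiB))// ler_norm.
Qed.

(** Indexed by words of coordinates, as they come from expanding the [d]-th power of the scalar
    product by distributivity. *)
Definition moment d (j : {ffun 'I_d -> 'I_n}) : R :=
  \int[mu n]_xi (G xi * \prod_(k < d) xi ord0 (j k)).

Let prod_coord_le d (j : {ffun 'I_d -> 'I_n}) (xi : 'rV[R]_n) :
  (forall i, `|xi ord0 i| <= B) -> `|\prod_(k < d) xi ord0 (j k)| <= B ^+ d.
Proof.
move=> xiB; rewrite normr_prod (_ : B ^+ d = \prod_(k < d) B); last first.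
  by rewrite prodr_const card_ord.
by apply: ler_prod => k _; rewrite normr_ge0 xiB.
Qed.

Let measurable_prod_coord d (j : {ffun 'I_d -> 'I_n}) :
  measurable_fun setT (fun xi : X => \prod_(k < d) xi ord0 (j k)).
Proof.
apply: measurable_prod => k _.
exact: (@measurable_coord _ (measurableTypeR R) n (j k)).
Qed.

Let integrable_moment d (j : {ffun 'I_d -> 'I_n}) :
  (mu n).-integrable setT (EFin \o (fun xi => G xi * \prod_(k < d) xi ord0 (j k))).
Proof.
apply: (integrable_on_box (M := B ^+ d)); first exact: measurable_prod_coord.
exact: prod_coord_le.
Qed.

Let moment_le d (j : {ffun 'I_d -> 'I_n}) :
  `|moment j| <= B ^+ d * \int[mu n]_xi `|G xi|.
Proof.
apply: le_trans (le_normr_Rintegral measurableT (integrable_moment j)) _.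
have intG' := integrable_abse intG.
rewrite -RintegralZl//; apply: le_Rintegral => //.
- exact: integrable_abse (integrable_moment j).
- exact: (integrableZl measurableT (B ^+ d) intG').
- move=> xi _; rewrite normrM mulrC.
  have [->|xiB] := boxP xi; first by rewrite normr0 !mulr0.
  by rewrite ler_wpM2r// prod_coord_le.
Qed.

Let dotp_expn (x xi : 'rV[R]_n) d :
  dotp x xi ^+ d = \sum_(j : {ffun 'I_d -> 'I_n})
    (\prod_(k < d) x ord0 (j k)) * \prod_(k < d) xi ord0 (j k).
Proof.
have -> : dotp x xi ^+ d = \prod_(k < d) dotp x xi by rewrite prodr_const card_ord.
rewrite /dotp bigA_distr_bigA/=; apply: eq_bigr => j _.
by rewrite big_split.
Qed.

Variable a : R^nat.
Hypothesis a_le : forall d, `|a d| <= (d`!%:R)^-1.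

Definition moment_poly d : mpoly.mpoly n R :=
  tensor_poly (fun j : {ffun 'I_d -> 'I_n} => a d * moment j).

(** There are [n ^ d] words, each moment is at most [B ^+ d] times the L^1 norm of [G], and [a d] is
    at most 1/d!; the norms at radius [r] are thus dominated by an exponential series at
    [n%:R * B * r]. *)
Lemma entire_moment_poly : entire moment_poly.
Proof.
move=> r r0; set N := \int[mu n]_xi `|G xi|.
have N0 : 0 <= N by exact: Rintegral_ge0.
have := is_cvg_seriesZ (k := N) (is_cvg_series_exp_coeff (n%:R * B * r : R)).
apply: series_dominated => d; rewrite ger0_norm; last exact: wnorm_ge0.
apply: le_trans (wnorm_tensor_poly _ r0) _.
apply: (@le_trans _ _ (\sum_(j : {ffun 'I_d -> 'I_n}) (d`!%:R)^-1 * (B ^+ d * N) * r ^+ d)).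
  apply: ler_sum => j _; rewrite ler_wpM2r ?exprn_ge0// normrM.
  by apply: ler_pM => //; exact: moment_le.
rewrite sumr_const card_ffun !card_ord -[_ *+ (n ^ d)]mulr_natl natrX /exp_coeff /=.
rewrite -[leRHS]/(N * ((n%:R * B * r) ^+ d / d`!%:R)) !exprMn le_eqVlt.
by apply/orP; left; apply/eqP; ring.
Qed.

Let integrable_power x d :
  (mu n).-integrable setT (EFin \o (fun xi => G xi * (a d * dotp x xi ^+ d))) /\
  \int[mu n]_xi (G xi * (a d * dotp x xi ^+ d)) = mpoly.meval (x ord0) (moment_poly d).
Proof.
pose F (j : {ffun 'I_d -> 'I_n}) (xi : 'rV[R]_n) :=
  (a d * \prod_(k < d) x ord0 (j k)) * (G xi * \prod_(k < d) xi ord0 (j k)).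
have intF j : (mu n).-integrable setT (EFin \o F j).
  exact: (integrableZl measurableT _ (integrable_moment j)).
have FE : (fun xi => G xi * (a d * dotp x xi ^+ d)) = fun xi => \sum_j F j xi.
  apply/funext => xi; rewrite dotp_expn !mulr_sumr; apply: eq_bigr => j _.
  by rewrite /F; ring.
have [int1 int2] := Rintegral_sum (index_enum {ffun 'I_d -> 'I_n}) intF.
rewrite FE; split=> //; rewrite int2 meval_tensor_poly; apply: eq_bigr => j _.
have im := integrable_moment j; rewrite RintegralZl//.
by rewrite /moment; ring.
Qed.

Lemma homogeneous_moment_poly d : homogeneous d (moment_poly d).
Proof.
move=> t v; rewrite !meval_tensor_poly mulr_sumr; apply: eq_bigr => j _.
by rewrite big_split/= prodr_const card_ord; ring.
Qed.

(** Where [G] is nonzero, <x,xi> is bounded by [T], so all partial sums are at most [expR T] and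
    dominated convergence exchanges sum and integral. *)
Lemma entire_sum_moment_poly (phi : R -> R) (x : 'rV[R]_n) :
  measurable_fun setT phi ->
  (forall t, series (fun d => a d * t ^+ d) @ \oo --> phi t) ->
  \int[mu n]_xi (G xi * phi (dotp x xi)) = entire_sum moment_poly (x ord0).
Proof.
move=> mphi cphi; pose T := \sum_i `|x ord0 i| * B.
have T0 : 0 <= T by apply: sumr_ge0 => i _; rewrite mulr_ge0.
have dotpT (xi : 'rV[R]_n) : (forall i, `|xi ord0 i| <= B) -> `|dotp x xi| <= T.
  move=> xiB; apply: le_trans (ler_norm_sum _ _ _) _; apply: ler_sum => i _.
  by rewrite normrM ler_wpM2l.
apply/esym/cvg_lim => //.
rewrite (_ : series _ = fun N => \int[mu n]_xi
    (G xi * series (fun d => a d * dotp x xi ^+ d) N)); last first.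
  apply/funext => N; rewrite /series/=.
  have [_ ] := Rintegral_sum (index_iota 0 N) (fun d => (integrable_power x d).1).
  under [X in _ = X -> _]eq_bigr do rewrite (integrable_power x _).2.
  by move=> <-; apply: eq_Rintegral => xi _; rewrite mulr_sumr.
have mseries N : measurable_fun [set: X]
    (fun xi : X => series (fun d => a d * dotp x xi ^+ d) N).
  apply: measurable_sum => d; apply: measurable_funM => //.
  by apply: measurable_funX; exact: measurable_dotpr.
apply: (@Rdominated_convergence _ X R (mu n)
  (fun N xi => G xi * series (fun d => a d * dotp x xi ^+ d) N)
  (fun xi => G xi * phi (dotp x xi)) (fun xi => expR T * `|G xi|)).
- by move=> N; exact: measurable_funM.
- by apply: measurable_funM => //; apply: (measurableT_comp mphi); exact: measurable_dotpr.
- by move=> xi; apply: cvgM; [exact: cvg_cst|exact: cphi].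
- exact: (integrableZl measurableT (expR T) (integrable_abse intG)).
- move=> N xi; have [->|xiB] := boxP xi; first by rewrite mul0r normr0 mulr0.
  rewrite normrM mulrC ler_wpM2r//.
  apply: le_trans (ler_norm_sum _ _ _) _.
  apply: (@le_trans _ _ (series (exp_coeff T) N)).
    apply: ler_sum => d _; rewrite normrM normrX /exp_coeff /= mulrC.
    by apply: ler_pM => //; rewrite ?exprn_ge0// lerXn2r ?nnegrE// dotpT.
  rewrite expRE (_ : pseries _ T = series (exp_coeff T)); last first.
    by congr series; apply/funext => d; rewrite /exp_coeff/= mulrC.
  apply: series_le_lim => [k|]; last exact: is_cvg_series_exp_coeff.
  by rewrite /exp_coeff/= divr_ge0 ?exprn_ge0.
Qed.

End EntireIntegral.

Section EntireAdd.
Variables (R : realType) (n : nat) (P Q : (mpoly.mpoly n R)^nat).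
Hypotheses (eP : entire P) (eQ : entire Q).

Lemma entire_add : entire (fun d => P d + Q d).
Proof.
move=> r r0; have := is_cvg_seriesD (eP r0) (eQ r0).
apply: series_dominated => d; rewrite ger0_norm; last exact: wnorm_ge0.
exact: wnormD.
Qed.

Lemma entire_sum_add v : entire_sum (fun d => P d + Q d) v = entire_sum P v + entire_sum Q v.
Proof.
rewrite /entire_sum -lim_seriesD; [|exact: entire_cvg..].
congr (limn (series _)); apply/funext => d; exact: mpoly.mevalD.
Qed.

End EntireAdd.

Section RealEntire.
Variables (R : realType) (n : nat) (u : 'rV[R]_n -> R) (B : R).
Local Notation mu := (@lebesgue_rV R).
Hypothesis intu : (mu n).-integrable setT (EFin \o u).
Hypothesis u_cont : continuous u.
Hypothesis B_ge0 : 0 <= B.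
Hypothesis cos_supp : forall (xi : 'rV[R]_n) i, B < `|xi ord0 i| -> cos_transform u xi = 0.
Hypothesis sin_supp : forall (xi : 'rV[R]_n) i, B < `|xi ord0 i| -> sin_transform u xi = 0.

Let coef_le (b : bool) k d : `|b%:R * (-1) ^+ k / d`!%:R| <= (d`!%:R : R)^-1.
Proof.
rewrite !normrM normrX normrN1 expr1n mulr1 normfV ger0_norm// [X in _ / X]ger0_norm//.
by rewrite ler_piMl ?invr_ge0//; case: b.
Qed.

(** The inversion formula presents [u] as a cosine integral against [Gc] plus a sine integral
    against [Gs]. Both densities are integrable and vanish off the box, so each integral expands
    into its moment polynomials. *)
Lemma bandlimited_entire : exists P : (mpoly.mpoly n R)^nat,
  [/\ entire P, forall d, homogeneous d (P d) &
   forall x, u x = entire_sum P (x ord0)].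
Proof.
have [c uE] := inversion_formula intu u_cont cos_supp sin_supp.
have [intc ints] := integrable_transforms intu cos_supp sin_supp.
pose Gc xi := c * cos_transform u xi; pose Gs xi := c * sin_transform u xi.
have intGc : (mu n).-integrable setT (EFin \o Gc).
  exact: (integrableZl measurableT c intc).
have intGs : (mu n).-integrable setT (EFin \o Gs).
  exact: (integrableZl measurableT c ints).
have Gc_supp (xi : 'rV[R]_n) i : B < `|xi ord0 i| -> Gc xi = 0.
  by move=> /cos_supp xi0; rewrite /Gc xi0 mulr0.
have Gs_supp (xi : 'rV[R]_n) i : B < `|xi ord0 i| -> Gs xi = 0.
  by move=> /sin_supp xi0; rewrite /Gs xi0 mulr0.
(* Taylor coefficients of cosine and, next, of sine; the parity factor makes the truncated [d.-1./2]
   harmless at even [d]. *)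
pose ac d : R := (~~ odd d)%:R * (-1) ^+ d./2 / d`!%:R.
pose as_ d : R := (odd d)%:R * (-1) ^+ d.-1./2 / d`!%:R.
have ac_le d : `|ac d| <= d`!%:R^-1 by exact: coef_le.
have as_le d : `|as_ d| <= d`!%:R^-1 by exact: coef_le.
have eC := entire_moment_poly intGc Gc_supp ac_le.
have eS := entire_moment_poly intGs Gs_supp as_le.
exists (fun d => moment_poly Gc ac d + moment_poly Gs as_ d); split.
- exact: entire_add.
- by move=> d t v; rewrite !mpoly.mevalD !homogeneous_moment_poly mulrDr.
move=> x; rewrite entire_sum_add//.
rewrite -(entire_sum_moment_poly intGc B_ge0 Gc_supp ac_le (phi := cos)); last 2 first.
- exact: continuous_measurable_fun (@continuous_cos R).
- move=> t; have := @is_cvg_series_cos_coeff R t; rewrite cosE.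
  by rewrite cos_coeffE.
rewrite -(entire_sum_moment_poly intGs B_ge0 Gs_supp as_le (phi := sin)); last 2 first.
- exact: continuous_measurable_fun (@continuous_sin R).
- move=> t; have := @is_cvg_series_sin_coeff R t; rewrite sinE.
  by rewrite sin_coeffE.
have icos : (mu n).-integrable setT (EFin \o (fun xi => Gc xi * cos (dotp x xi))).
  apply: (integrable_mul_bounded (M := 1)) => // [|y]; last exact: cos_max.
  by apply: measurable_cos_comp; exact: measurable_dotpr.
have isin : (mu n).-integrable setT (EFin \o (fun xi => Gs xi * sin (dotp x xi))).
  apply: (integrable_mul_bounded (M := 1)) => // [|y]; last exact: sin_max.
  by apply: measurable_sin_comp; exact: measurable_dotpr.
rewrite -RintegralD// uE -RintegralZl//; last first.
  exact: (integrable_inverse_integrand intu cos_supp sin_supp).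
by apply: eq_Rintegral => xi _; rewrite /inverse_integrand /Gc /Gs; ring.
Qed.

End RealEntire.

(** * Reduction of a complex function to its real and imaginary parts *)

Section ComplexReduction.
Local Open Scope complex_scope.
Variables (R : realType) (n : nat) (f : 'rV[R]_n -> R[i]).
Local Notation mu := (@lebesgue_rV R).
Local Notation X := 'rV[measurableTypeR R]_n.
Local Notation u := (fun x => complex.Re (f x)).
Local Notation v := (fun x => complex.Im (f x)).
Hypothesis f_L1 : complex_integrable f.

Lemma Re_fourier xi : complex.Re (fourier f xi) = cos_transform u xi + sin_transform v xi.
Proof.
have [intu intv] := f_L1.
rewrite /fourier /complex_integral/= -RintegralD//; last 2 first.
- exact: integrable_cos_transform.
- exact: integrable_sin_transform.
apply: eq_Rintegral => y _; case: (f y) => a b /=.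
by rewrite cosN sinN mulrN opprK.
Qed.

Lemma Im_fourier xi : complex.Im (fourier f xi) = cos_transform v xi - sin_transform u xi.
Proof.
have [intu intv] := f_L1.
rewrite /fourier /complex_integral/= -RintegralB//; last 2 first.
- exact: integrable_cos_transform.
- exact: integrable_sin_transform.
apply: eq_Rintegral => y _; case: (f y) => a b /=.
by rewrite cosN sinN mulrN addrC.
Qed.

Lemma dotpN (x xi : 'rV[R]_n) : dotp x (- xi) = - dotp x xi.
Proof. by rewrite /dotp -sumrN; apply: eq_bigr => i _; rewrite mxE mulrN. Qed.

Lemma cos_transformN (w : 'rV[R]_n -> R) xi : cos_transform w (- xi) = cos_transform w xi.
Proof. by apply: eq_Rintegral => y _; rewrite dotpN cosN. Qed.

Lemma sin_transformN (w : 'rV[R]_n -> R) xi : (mu n).-integrable setT (EFin \o w) ->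
  sin_transform w (- xi) = - sin_transform w xi.
Proof.
move=> intw; have iw := integrable_sin_transform intw xi.
rewrite -[RHS]mulN1r /sin_transform -RintegralZl//; apply: eq_Rintegral => y _.
by rewrite dotpN sinN mulrN mulN1r.
Qed.

(* The cosine transforms are even and the sine transforms are odd in [xi]. *)
Lemma transforms_eq0 xi : fourier f xi = 0 -> fourier f (- xi) = 0 ->
  [/\ cos_transform u xi = 0, sin_transform u xi = 0,
      cos_transform v xi = 0 & sin_transform v xi = 0].
Proof.
have [intu intv] := f_L1.
move=> f0 fN0; have := Re_fourier xi; have := Im_fourier xi.
have := Re_fourier (- xi); have := Im_fourier (- xi).
rewrite f0 fN0 !cos_transformN !sin_transformN//=.
move: (cos_transform u xi) (sin_transform u xi) (cos_transform v xi) (sin_transform v xi).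
move=> cu su cv sv h1 h2 h3 h4; split; lra.
Qed.

Lemma compact_support_box : compactly_supported (fourier f) ->
  exists2 B : R, 0 <= B & forall (xi : 'rV[R]_n) i, B < `|xi ord0 i| -> fourier f xi = 0.
Proof.
(* The bounds provided are those strictly above [M], which may be negative; [|M| + 1] is one of them
   and is nonnegative. *)
move=> /compact_bounded[M [_ MP]]; exists (`|M| + 1); first by rewrite addr_ge0.
move=> xi i xiB; apply/eqP; apply: contraLR xiB => f0; rewrite -leNgt.
have : `|xi| <= `|M| + 1.
  apply: MP; first by rewrite ltr_pwDr// ler_norm.
  by apply: subset_closure.
apply: le_trans.
by rewrite [leRHS]mx_normrE (le_bigmax _ (fun ij => `|xi ij.1 ij.2|) (ord0, i)).
Qed.

Lemma Re_continuous : continuous (f : 'rV[R]_n -> R[i]^o) -> continuous u.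
Proof.
move=> cf x; have Fx : Filter (nbhs (x : 'rV[R]_n)) by exact: nbhs_filter.
apply/cvgrPdist_le => e e0.
have ec0 : 0 < e%:C :> R[i] by rewrite ltcR.
have fx : (f : 'rV[R]_n -> R[i]^o) y @[y --> x] --> (f x : R[i]^o) := @cf x.
move/(@cvgrPdist_le R[i] R[i]^o): fx => /(_ _ ec0); apply: filterS => y.
move=> le_e; rewrite -lecR; apply: le_trans le_e.
apply: le_trans (normc_ge_Re _).
by case: (f x) (f y) => [a b] [c d].
Qed.

Lemma Im_continuous : continuous (f : 'rV[R]_n -> R[i]^o) -> continuous v.
Proof.
move=> cf x; have Fx : Filter (nbhs (x : 'rV[R]_n)) by exact: nbhs_filter.
apply/cvgrPdist_le => e e0.
have ec0 : 0 < e%:C :> R[i] by rewrite ltcR.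
have fx : (f : 'rV[R]_n -> R[i]^o) y @[y --> x] --> (f x : R[i]^o) := @cf x.
move/(@cvgrPdist_le R[i] R[i]^o): fx => /(_ _ ec0); apply: filterS => y.
move=> le_e; rewrite -lecR; apply: le_trans le_e.
case: (f x) (f y) => [a b] [c d] /=.
rewrite normc_def lecR /= -sqrtr_sqr ler_sqrt ?lerDr ?sqr_ge0//.
by rewrite addr_ge0 ?sqr_ge0.
Qed.

End ComplexReduction.

Local Open Scope complex_scope.

Theorem theorem1p3 (R : realType) (K : topologicalGroupType) (n l : nat)
  (act : K -> 'rV[R]_n -> 'rV[R]_n) (rho : l.-tuple (mpoly.mpoly n R))
  (cptK : compact [set: K]) (actP : orthogonal_action act)
  (rhoP : generates_invariants act rho)
  (f : 'rV[R]_n -> R[i])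
  (f_L1 : complex_integrable f)
  (f_inv : invariant_fun act f)
  (f_ft : compactly_supported (fourier f))
  (f_cont : continuous (f : 'rV[R]_n -> R[i]^o)) :
  exists2 h : 'rV[R]_l -> R[i], real_analytic h &
    forall x : 'rV[R]_n, f x = h (\row_(j < l) polyfun (tnth rho j) x).
Proof.
have [B B0 fB] := compact_support_box f_ft.
(* The box is symmetric, so the transform vanishes at [- xi] as well; both values are needed to
   separate the four real transforms. *)
have fBN (xi : 'rV[R]_n) i : B < `|xi ord0 i| -> fourier f (- xi) = 0.
  by move=> xiB; apply: (fB _ i); rewrite mxE normrN.
have tr0 (xi : 'rV[R]_n) i (xiB : B < `|xi ord0 i|) :=
  transforms_eq0 f_L1 (fB xi i xiB) (fBN xi i xiB).
have [intu intv] := f_L1.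
have [||P1 [eP1 hP1 P1E]] := bandlimited_entire intu (Re_continuous f_cont) B0.
- by move=> xi i /tr0[].
- by move=> xi i /tr0[].
have [||P2 [eP2 hP2 P2E]] := bandlimited_entire intv (Im_continuous f_cont) B0.
- by move=> xi i /tr0[].
- by move=> xi i /tr0[].
have [k x|q1 eq1 q1E] := invariant_entire_comp actP rhoP eP1 hP1 P1E.
  by rewrite f_inv.
have [k x|q2 eq2 q2E] := invariant_entire_comp actP rhoP eP2 hP2 P2E.
  by rewrite f_inv.
(* The real and imaginary parts of [f] were factored through [rho] separately; [h] recombines the
   two entire series. *)
exists (fun y => entire_sum q1 (y ord0) +i* entire_sum q2 (y ord0)).
  exact: entire_real_analytic.
by move=> x; rewrite -q1E -q2E; case: (f x).
Qed.
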